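(* Let $E$ be a finite set with at least three elements. The image of the cross-ratio embedding $\mathfrak B_E:\widehat{\mathbf{Mod}}_E\to \mathbb S^{\mathrm{Quad}_E}$ of the space of isomorphism classes of trees of spheres marked by $E$ is equal to the closure in $\mathbb S^{\mathrm{Quad}_E}$ (product topology) of $\mathfrak B_E(\mathbf{Mod}_E)$, the image of the moduli space of spheres marked by $E$: $$\mathfrak B_E(\widehat{\mathbf{Mod}}_E)=\overline{\mathfrak B_E(\mathbf{Mod}_E)}.$$
   Context: $\mathbb S=\mathbb P^1(\mathbb C)$ is the Riemann sphere. A combinatorial tree marked by $E$ is a finite tree $T$ whose set of leaves (external vertices) is $E$ and all of whose internal vertices have valence at least $3$. A tree of spheres $\mathcal T$ marked by $E$ is a combinatorial tree $T$ marked by $E$ together with, for each internal vertex $v$, a Riemann sphere (copy of $\mathbb P^1(\mathbb C)$ up to isomorphism) $\mathbb S_v$ and an injection $i_v$ of the set of edges adjacent to $v$ into $\mathbb S_v$; one defines $a_v:E\to\mathbb S_v$ by $a_v(x)=i_v(e)$, where $e$ is the edge at $v$ lying in the same connected component of $T\setminus\{v\}$ as $x$. An isomorphism between trees of spheres $\mathcal T_1,\mathcal T_2$ marked by $E$ is a bijective map $M:T_1\to T_2$ of combinatorial trees (internal vertices to internal vertices, leaves to leaves, edges to edges, adjacent vertices to adjacent vertices) restricting to the identity on $E$, together with, for each internal vertex $v$ of $T_1$, a projective isomorphism $m_v:\mathbb S_v\to\mathbb S_{M(v)}$ mapping the attaching point $i_v(e)$ to $i_{M(v)}(M(e))$ for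 each edge $e$ at $v$. $\widehat{\mathbf{Mod}}_E$ is the set of isomorphism classes of trees of spheres marked by $E$; $\mathbf{Mod}_E\subset\widehat{\mathbf{Mod}}_E$ is the set of classes of trees with a unique internal vertex. It is identified with the moduli space of injections $E\to\mathbb S$ modulo post-composition by Moebius transformations (a tree with unique internal vertex $v$ corresponds to $[a_v]$). For a triple $t=(x_0,x_1,x_\infty)$ of distinct elements of $E$, let $v_t$ be the unique vertex of $T$ such that $x_0,x_1,x_\infty$ lie in three different components of $T\setminus\{v_t\}$, let $\sigma_t:\mathbb S_{v_t}\to\mathbb S$ be the unique projective isomorphism with $\sigma_t(a_{v_t}(x_0))=0$, $\sigma_t(a_{v_t}(x_1))=1$, $\sigma_t(a_{v_t}(x_\infty))=\infty$, and put $\alpha_t=\sigma_t\circ a_{v_t}:E\to\mathbb S$ (this depends only on the class $[\mathcal T]$). $\mathrm{Quad}_E$ is the set of quadruples of distinct elements of $E$, and $\mathfrak B_E([\mathcal T])=(\alpha_t(x))_{(t,x)\in\mathrm{Quad}_E}$. On $\mathbf{Mod}_E$ this is the collection of all cross ratios. *)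

(* Defs.v *)
From HB Require Import structures.
From mathcomp Require Import all_boot all_order all_algebra all_real_closed.
From mathcomp Require Import complex generic_quotient ring.
From mathcomp Require Import all_classical all_reals topology normedtype.

Set Implicit Arguments.
Unset Strict Implicit.
Unset Printing Implicit Defensive.

Import Order.TTheory GRing.Theory Num.Theory.
Import numFieldNormedType.Exports.

Local Open Scope classical_set_scope.
Local Open Scope ring_scope.
Local Open Scope complex_scope.
Local Open Scope quotient_scope.

(* [R[i]] does not inherit the metric topology of its modulus by default. *)
HB.instance Definition _ (R : rcfType) := NormedModule.copy R[i] R[i]^o.

(* The Riemann sphere: [Some z] is the point z of C, [None] is infinity. *)
Notation sphere R := (one_point_compactification R[i]).

Section Sphere.
Variable R : realType.
Implicit Types (z p : sphere R) (m : sphere R -> sphere R).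

Definition homog z : R[i] * R[i] := if z is Some w then (w, 1) else (1, 0).

Definition of_homog (u : R[i] * R[i]) : sphere R :=
  if u.2 == 0 then None else Some (u.1 / u.2).

Definition homography (a b c d : R[i]) z : sphere R :=
  of_homog (a * (homog z).1 + b * (homog z).2, c * (homog z).1 + d * (homog z).2).

Definition projective_iso m : Prop :=
  exists a b c d : R[i], a * d - b * c != 0 /\ m = homography a b c d.

(* The projective isomorphism sending p0, p1, poo to 0, 1, oo; it exists and is
   unique when these three points are distinct, otherwise the value is irrelevant. *)
Definition normalizer p0 p1 poo : sphere R -> sphere R :=
  get [set m : sphere R -> sphere R | [/\ projective_iso m, m p0 = Some 0, m p1 = Some 1
                     & m poo = None]].

Lemma of_homogZ k u v : k != 0 -> of_homog (k * u, k * v) = of_homog (u, v).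
Proof.
move=> k0; rewrite /of_homog /= mulf_eq0 (negPf k0) /=.
by case: eqP => // _; rewrite -mulf_div divff // mul1r.
Qed.

Lemma homogK u v : (u != 0) || (v != 0) ->
  exists2 k, k != 0 & (u, v) = (k * (homog (of_homog (u, v))).1,
                                k * (homog (of_homog (u, v))).2).
Proof.
rewrite /of_homog /=; have [->|v0] := eqVneq v 0 => /=.
  by rewrite orbF => u0; exists u; rewrite ?mulr1 ?mulr0.
by move=> _; exists v; rewrite // mulr1 mulrC divfK.
Qed.

Lemma homog_neq0 z : ((homog z).1 != 0) || ((homog z).2 != 0).
Proof. by case: z => [w|] /=; rewrite oner_eq0 ?orbT. Qed.

Lemma of_homogK : cancel homog of_homog.
Proof. by case=> [w|]; rewrite /of_homog /= ?oner_eq0 ?divr1 ?eqxx. Qed.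

Lemma homography_comp a b c d a' b' c' d' : a * d - b * c != 0 ->
  homography a' b' c' d' \o homography a b c d =
  homography (a' * a + b' * c) (a' * b + b' * d)
             (c' * a + d' * c) (c' * b + d' * d).
Proof.
move=> D0; apply: funext => z /=.
rewrite {2}/homography; set u := a * _ + _; set v := c * _ + _.
have uv0 : (u != 0) || (v != 0).
  rewrite -negb_and; apply/negP => /andP[/eqP u0 /eqP v0].
  have e1 : (a * d - b * c) * (homog z).1 = 0.
    by transitivity (d * u - b * v); [rewrite /u /v; ring|rewrite u0 v0; ring].
  have e2 : (a * d - b * c) * (homog z).2 = 0.
    by transitivity (a * v - c * u); [rewrite /u /v; ring|rewrite u0 v0; ring].
  move: (homog_neq0 z).
  move/eqP: e1; rewrite mulf_eq0 (negPf D0) /= => ->.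
  by move/eqP: e2; rewrite mulf_eq0 (negPf D0) /= => ->.
have [k k0 e] := homogK uv0.
rewrite {1}/homography -(of_homogZ _ _ k0) /homography.
set h := homog (of_homog (u, v)) in e *.
case: e => eu ev.
rewrite !mulrDr !(mulrCA k) -eu -ev /u /v.
by congr (of_homog (_, _)); ring.
Qed.

Lemma homography1 a : a != 0 -> homography a 0 0 a = id.
Proof.
move=> a0; apply: funext => z /=.
rewrite /homography !mul0r addr0 add0r of_homogZ //.
by rewrite -surjective_pairing of_homogK.
Qed.

Lemma projective_iso_id : projective_iso id.
Proof.
exists 1, 0, 0, 1; split; last by rewrite homography1 ?oner_eq0.
by rewrite mulr1 mulr0 subr0 oner_eq0.
Qed.

Lemma projective_iso_comp m m' :
  projective_iso m -> projective_iso m' -> projective_iso (m' \o m).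
Proof.
move=> [a [b [c [d [D0 ->]]]]] [a' [b' [c' [d' [D0' ->]]]]].
rewrite homography_comp //.
do 4!eexists; split; last by reflexivity.
by move: (mulf_neq0 D0 D0'); congr (_ != 0); ring.
Qed.

Lemma projective_iso_inv m : projective_iso m ->
  exists m', [/\ projective_iso m', cancel m m' & cancel m' m].
Proof.
move=> [a [b [c [d [D0 ->]]]]]; exists (homography d (- b) (- c) a).
have D0' : d * a - - b * - c != 0 by move: D0; congr (_ != 0); ring.
split; first by exists d, (- b), (- c), a.
- move=> z; rewrite -[LHS]/((homography _ _ _ _ \o homography _ _ _ _) z).
  rewrite homography_comp // -[RHS]/(id z) -(homography1 D0).
  by congr (homography _ _ _ _ z); ring.
- move=> z; rewrite -[LHS]/((homography _ _ _ _ \o homography _ _ _ _) z).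
  rewrite homography_comp // -[RHS]/(id z) -(homography1 D0).
  by congr (homography _ _ _ _ z); ring.
Qed.

End Sphere.

(* The vertices are the leaves [inl x], for x in E, and the internal vertices
   [inr v]. A finite tree with r internal vertices is given up to the naming of
   these vertices, which are taken to be the elements of ['I_r]. *)
Record comb_tree (E : finType) := CombTree {
  internal : nat;
  adj : E + 'I_internal -> E + 'I_internal -> bool;
  adj_sym : symmetric adj;
  adj_irr : irreflexive adj;
  tree_connected : forall u w, connect adj u w;
  tree_acyclic : forall c, ucycle adj c -> (size c < 3)%N;
  leaf_valence : forall x : E, #|adj (inl x)| = 1%N;
  internal_valence : forall v : 'I_internal, (3 <= #|adj (inr v)|)%N }.

Notation vertex E T := (E + 'I_(internal T))%type.

Section CombTree.
Variables (E : finType) (T : comb_tree E).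
Implicit Types (u w s : vertex E T) (v : 'I_(internal T)) (x : E).

(* w and s lie in the same connected component of T minus the vertex u. *)
Definition same_component u w s : bool :=
  [&& w != u, s != u &
      connect [rel p q | [&& adj p q, p != u & q != u]] w s].

Definition separates v (x0 x1 xoo : E) : bool :=
  [&& ~~ same_component (inr v) (inl x0) (inl x1),
      ~~ same_component (inr v) (inl x1) (inl xoo) &
      ~~ same_component (inr v) (inl x0) (inl xoo)].

(* The vertex v_t; it exists and is unique when x0, x1, xoo are distinct. *)
Definition median (x0 x1 xoo : E) : option 'I_(internal T) :=
  [pick v | separates v x0 x1 xoo].

End CombTree.

(* Each sphere S_v is a copy of the Riemann sphere. The edge joining v to w is
   designated by its endpoint w: only the values of [attach v] at the
   neighbours of v are relevant. *)
Record sphere_tree (R : realType) (E : finType) := SphereTree {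
  shape : comb_tree E;
  attach : 'I_(internal shape) -> vertex E shape -> sphere R;
  attach_inj : forall v, {in adj (inr v) &, injective (attach v)} }.

Section SphereTree.
Variables (R : realType) (E : finType).
Implicit Types (T : sphere_tree R E).

(* a_v(x): the attaching point at v of the edge leading to x. The branch [None]
   does not occur. *)
Definition attach_leaf T (v : 'I_(internal (shape T))) (x : E) : sphere R :=
  if [pick w | adj (inr v) w && same_component (inr v) w (inl x)] is Some w
  then attach v w else None.

(* alpha_t(x) for t = (x0, x1, xoo). The branch [None] does not occur when
   x0, x1, xoo are distinct. *)
Definition alpha T (x0 x1 xoo x : E) : sphere R :=
  if median (shape T) x0 x1 xoo is Some v then
    normalizer (attach_leaf v x0) (attach_leaf v x1) (attach_leaf v xoo)
               (attach_leaf v x)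
  else None.

Definition vertex_map (r1 r2 : nat) (f : 'I_r1 -> 'I_r2) (u : E + 'I_r1) :
    E + 'I_r2 :=
  match u with inl x => inl x | inr v => inr (f v) end.

Definition sphere_tree_iso T1 T2 : Prop :=
  exists (f : 'I_(internal (shape T1)) -> 'I_(internal (shape T2)))
         (m : 'I_(internal (shape T1)) -> sphere R -> sphere R),
    [/\ bijective f,
        forall u w, adj (vertex_map f u) (vertex_map f w) = adj u w,
        forall v, projective_iso (m v)
      & forall v w, adj (inr v) w ->
          m v (attach v w) = attach (f v) (vertex_map f w)].

Lemma sphere_tree_iso_refl T : sphere_tree_iso T T.
Proof.
exists id, (fun=> id).
have vE : vertex_map (@id 'I_(internal (shape T))) = id
  by apply: funext => -[].
split=> [|u w|v|v w _]; rewrite ?vE //; [exact: Bijective | exact: projective_iso_id].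
Qed.

Lemma sphere_tree_iso_trans T2 T1 T3 :
  sphere_tree_iso T1 T2 -> sphere_tree_iso T2 T3 -> sphere_tree_iso T1 T3.
Proof.
move=> [f [m [fb fa mp me]]] [g [n [gb ga np ne]]].
exists (g \o f), (fun v => n (f v) \o m v).
have vE u : vertex_map (g \o f) u = vertex_map g (vertex_map f u) by case: u.
split=> [|u w|v|v w vw]; rewrite ?vE ?ga ?fa //.
- exact: bij_comp.
- exact: projective_iso_comp.
- by rewrite /= me // ne // -[inr (f v)]/(vertex_map f (inr v)) fa.
Qed.

Lemma sphere_tree_iso_sym T1 T2 :
  sphere_tree_iso T1 T2 -> sphere_tree_iso T2 T1.
Proof.
move=> [f [m [[g fK gK] fa mp me]]].
have /choice[n nP] v := projective_iso_inv (mp v).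
have vK : cancel (vertex_map g) (vertex_map f) by case=> //= v; rewrite gK.
exists g, (fun v => n (g v)); split=> [|u w|v|v w vw].
- by exists f.
- by rewrite -fa !vK.
- by have [] := nP (g v).
- have [_ mK _] := nP (g v).
  have gvw : adj (inr (g v)) (vertex_map g w).
    by rewrite -fa vK /= gK.
  by move: (me _ _ gvw); rewrite vK gK => <-; rewrite mK.
Qed.

HB.instance Definition _ := gen_eqMixin (sphere_tree R E).
HB.instance Definition _ := gen_choiceMixin (sphere_tree R E).

Definition iso_rel : rel (sphere_tree R E) := fun T1 T2 =>
  `[< sphere_tree_iso T1 T2 >].

Lemma iso_rel_refl : reflexive iso_rel.
Proof. by move=> T; apply/asboolP/sphere_tree_iso_refl. Qed.

Lemma iso_rel_sym : symmetric iso_rel.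
Proof. by move=> T1 T2; apply/asboolP/asboolP => /sphere_tree_iso_sym. Qed.

Lemma iso_rel_trans : transitive iso_rel.
Proof.
move=> T2 T1 T3 /asboolP h1 /asboolP h2.
exact/asboolP/(sphere_tree_iso_trans h1 h2).
Qed.

Canonical iso_equiv := EquivRel iso_rel iso_rel_refl iso_rel_sym iso_rel_trans.
Canonical iso_encModRel := defaultEncModRel iso_rel.

End SphereTree.

Definition Mod_hat (R : realType) (E : finType) := {eq_quot @iso_rel R E}.

HB.instance Definition _ R E := Choice.on (Mod_hat R E).

Definition iso_class R E (T : sphere_tree R E) : Mod_hat R E :=
  \pi_{eq_quot @iso_rel R E} T.

Definition Mod (R : realType) (E : finType) : set (Mod_hat R E) :=
  [set iso_class T | T in [set T | internal (shape T) = 1%N]].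
Arguments Mod : clear implicits.

(* Quadruples ((x0, x1, xoo), x) of distinct elements. *)
Definition quad (E : finType) :=
  {q : E * E * E * E | uniq [:: q.1.1.1; q.1.1.2; q.1.2; q.2]}.

(* The value does not depend on the representative of the class. The target
   {ptws _ -> _} carries the product topology. *)
Definition cross_ratios (R : realType) (E : finType) (c : Mod_hat R E) :
    {ptws quad E -> sphere R} :=
  fun q => let: (x0, x1, xoo, x) := val q in
    alpha (repr (c : {eq_quot @iso_rel R E})) x0 x1 xoo x.

(* Main.v *)
From mathcomp Require Import all_boot all_order all_algebra.
From mathcomp Require Import all_classical all_reals topology normedtype.
From mathcomp Require Import sequences complex generic_quotient ring.
Require Import Defs.

(** Both inclusions are obtained from a description of the image that does
    not mention trees.

    A family of maps [A x0 x1 xoo : E -> sphere R], such as the [alpha] of a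
    tree, is [coherent] when two of its members always differ by a Moebius map
    or by a degenerate one, which collapses all but one point. The family of a
    tree of spheres is coherent ([alpha_coherent]): two triples of leaves either
    have the same median, and hence coordinates on the same sphere, or have
    different medians, and then every leaf is in the direction of the second as
    seen from the first, or of the first as seen from the second. The
    cross-ratios in the closure of the image of [Mod] are coherent as well
    ([closure_Mod_coherent]), because coherence follows from polynomial
    identities between brackets, which hold on [Mod] and are closed conditions.

    Conversely, fix a leaf [r] and put it at infinity. In a coherent family, the
    leaves that stay at finite distance when [x] and [y] are put at 0 and 1 form
    a cluster. Clusters are nested or disjoint, and with their coordinates they
    make up a [hierarchy] that determines the family ([coherent_realized]). From
    a hierarchy one gets:
    - a tree of spheres with the given family, whose internal vertices are the
      clusters ([alpha_hierarchy_tree]), so coherent families are in the image;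
    - configurations of distinct points with cross-ratios converging to the
      family ([cvg_smoothing]): each cluster is inserted in the larger ones after
      scaling by a power of a small parameter that depends on its size. So
      coherent families are in the closure of the image of [Mod]
      ([realized_closure_Mod]).

    Limits are taken in homogeneous coordinates, chosen continuously near the
    limit point ([local_homog]); near infinity this uses that discs of the
    complex plane are relatively compact. *)

Set Implicit Arguments.
Unset Strict Implicit.
Unset Printing Implicit Defensive.

Import Order.TTheory GRing.Theory Num.Theory.
Import numFieldNormedType.Exports.

Local Open Scope ring_scope.
Local Open Scope complex_scope.

(** * Cross-ratios on the Riemann sphere *)

Section CrossRatio.
Local Open Scope classical_set_scope.
Variable R : realType.
Implicit Types (p q : sphere R) (m : sphere R -> sphere R).

Definition wedge (u v : R[i] * R[i]) : R[i] := u.1 * v.2 - u.2 * v.1.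

Definition bracket p q : R[i] := wedge (homog p) (homog q).

(** The normalizing Moebius map written as a quotient of brackets; unlike
    [normalizer], this formula can be computed with and passed to the limit. *)
Definition cross_ratio p0 p1 poo p : sphere R :=
  of_homog (bracket p p0 * bracket poo p1, bracket p poo * bracket p0 p1).

Lemma eq_of_homog (u v u' v' : R[i]) :
  (u != 0) || (v != 0) -> (u' != 0) || (v' != 0) -> u * v' = u' * v ->
  of_homog (u, v) = of_homog (u', v').
Proof.
rewrite /of_homog /=.
have [->|v0] := eqVneq v 0; have [->|v0'] := eqVneq v' 0 => //=.
- rewrite orbF mulr0 => u0 _ /eqP.
  by rewrite mulf_eq0 (negPf u0) (negPf v0').
- rewrite orbF mulr0 => _ u0 /esym/eqP.
  by rewrite mulf_eq0 (negPf u0) (negPf v0).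
- move=> _ _ e; congr Some; apply: (mulIf v0); apply: (mulIf v0').
  by rewrite divfK // mulrAC divfK.
Qed.

Lemma bracket_eq0 p q : (bracket p q == 0) = (p == q).
Proof.
apply/eqP/eqP => [|->]; last by rewrite /bracket /wedge mulrC subrr.
move=> /eqP; rewrite subr_eq0 => /eqP e.
rewrite -[p]of_homogK -[q]of_homogK [homog p]surjective_pairing.
rewrite [homog q]surjective_pairing.
by apply: eq_of_homog; rewrite ?homog_neq0 // e mulrC.
Qed.

Lemma bracketC p q : bracket p q = - bracket q p.
Proof. by rewrite /bracket /wedge; ring. Qed.

(** The determinant of a linear map multiplies the bracket of two vectors, so
    that a projective isomorphism preserves brackets up to a factor in each
    argument. *)
Lemma bracket_projective_iso m : projective_iso m ->
  exists d (k : sphere R -> R[i]), [/\ d != 0, forall p, k p != 0 &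
    forall p q, d * bracket p q = k p * k q * bracket (m p) (m q)].
Proof.
move=> [a [b [c [d [D0 ->]]]]]; exists (a * d - b * c).
have /choice[k kP] : forall p, exists k, k != 0 /\
   (a * (homog p).1 + b * (homog p).2, c * (homog p).1 + d * (homog p).2) =
   (k * (homog (homography a b c d p)).1, k * (homog (homography a b c d p)).2).
  move=> p; rewrite /homography.
  set u := a * _ + _; set v := c * _ + _.
  suff uv0 : (u != 0) || (v != 0) by have [k k0 e] := homogK uv0; exists k.
  rewrite -negb_and; apply/negP => /andP[/eqP u0 /eqP v0].
  move: (homog_neq0 p); apply/negP; rewrite negb_or !negbK.
  apply/andP; split.
    suff /eqP : (a * d - b * c) * (homog p).1 = 0
      by rewrite mulf_eq0 (negPf D0).
    by transitivity (d * u - b * v); [rewrite /u /v; ring|rewrite u0 v0; ring].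
  suff /eqP : (a * d - b * c) * (homog p).2 = 0
    by rewrite mulf_eq0 (negPf D0).
  by transitivity (a * v - c * u); [rewrite /u /v; ring|rewrite u0 v0; ring].
exists k; split=> // [p|p q]; first by have [] := kP p.
have [_ [e1 e2]] := kP p; have [_ [e3 e4]] := kP q.
rewrite /bracket /wedge.
transitivity ((a * (homog p).1 + b * (homog p).2) *
              (c * (homog q).1 + d * (homog q).2) -
              (c * (homog p).1 + d * (homog p).2) *
              (a * (homog q).1 + b * (homog q).2)); first by ring.
by rewrite e1 e2 e3 e4; ring.
Qed.

Lemma projective_iso_inj m : projective_iso m -> injective m.
Proof. by move=> /projective_iso_inv[m' [_ mK _]]; exact: can_inj mK. Qed.

Lemma cross_ratio_projective_iso m p0 p1 poo p : projective_iso m ->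
  cross_ratio (m p0) (m p1) (m poo) (m p) = cross_ratio p0 p1 poo p.
Proof.
move=> /bracket_projective_iso[d [k [d0 k0 e]]]; rewrite /cross_ratio.
have dd0 : d * d != 0 by rewrite mulf_neq0.
have kk0 : k p * k p0 * k poo * k p1 != 0 by rewrite !mulf_neq0.
rewrite -(of_homogZ _ _ kk0) -[RHS](of_homogZ _ _ dd0).
congr (of_homog (_, _)).
  transitivity ((k p * k p0 * bracket (m p) (m p0)) *
                (k poo * k p1 * bracket (m poo) (m p1))); first by ring.
  by rewrite -!e; ring.
transitivity ((k p * k poo * bracket (m p) (m poo)) *
              (k p0 * k p1 * bracket (m p0) (m p1))); first by ring.
by rewrite -!e; ring.
Qed.

Lemma cross_ratio01oo p : cross_ratio (Some 0) (Some 1) None p = p.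
Proof.
rewrite /cross_ratio -[RHS]of_homogK /bracket.
case: (homog p) => u v.
by congr (of_homog (_, _)); rewrite /wedge /=; ring.
Qed.

Lemma cross_ratio_neq0 p0 p1 poo p : uniq [:: p0; p1; poo] ->
  (bracket p p0 * bracket poo p1 != 0) || (bracket p poo * bracket p0 p1 != 0).
Proof.
rewrite /= !inE negb_or andbT => /andP[/andP[n01 n0oo] n1oo].
rewrite -negb_and !mulf_eq0 !bracket_eq0 (negPf n01) orbF [poo == _]eq_sym.
rewrite (negPf n1oo) orbF; apply/negP => /andP[/eqP -> /eqP e].
by rewrite e eqxx in n0oo.
Qed.

Lemma Some1_neq0 : (Some 1 : sphere R) != Some 0.
Proof. by apply/eqP => -[/eqP]; rewrite oner_eq0. Qed.

Lemma projective_iso_cross_ratio p0 p1 poo : uniq [:: p0; p1; poo] ->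
  projective_iso (cross_ratio p0 p1 poo).
Proof.
rewrite /= !inE negb_or andbT => /andP[/andP[n01 n0oo] n1oo].
pose k1 := bracket poo p1; pose k2 := bracket p0 p1.
exists ((homog p0).2 * k1), (- (homog p0).1 * k1), ((homog poo).2 * k2),
  (- (homog poo).1 * k2); split.
  suff -> : (homog p0).2 * k1 * (- (homog poo).1 * k2) -
      - (homog p0).1 * k1 * ((homog poo).2 * k2) = k1 * k2 * bracket p0 poo.
    by rewrite !mulf_neq0 // bracket_eq0 // eq_sym.
  by rewrite /bracket /wedge; ring.
apply: funext => p; rewrite /cross_ratio /homography -/k1 -/k2.
by congr (of_homog (_, _)); rewrite /bracket /wedge; ring.
Qed.

Lemma cross_ratio_0 p0 p1 poo : uniq [:: p0; p1; poo] ->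
  cross_ratio p0 p1 poo p0 = Some 0.
Proof.
rewrite /= !inE negb_or andbT => /andP[/andP[n01 n0oo] n1oo].
rewrite /cross_ratio (_ : bracket p0 p0 = 0); last first.
  by apply/eqP; rewrite bracket_eq0.
by rewrite mul0r /of_homog /= mul0r mulf_eq0 !bracket_eq0 (negPf n01) (negPf n0oo).
Qed.

Lemma cross_ratio_1 p0 p1 poo : uniq [:: p0; p1; poo] ->
  cross_ratio p0 p1 poo p1 = Some 1.
Proof.
rewrite /= !inE negb_or andbT => /andP[/andP[n01 n0oo] n1oo].
rewrite /cross_ratio /of_homog /= mulf_eq0 !bracket_eq0 (negPf n01) (negPf n1oo).
rewrite /= (bracketC p1 p0) (bracketC poo) mulrNN (mulrC (bracket p0 p1)) divff //.
by rewrite mulf_eq0 !bracket_eq0 negb_or n1oo n01.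
Qed.

Lemma cross_ratio_oo p0 p1 poo : cross_ratio p0 p1 poo poo = None.
Proof.
rewrite /cross_ratio (_ : bracket poo poo = 0); last first.
  by apply/eqP; rewrite bracket_eq0.
by rewrite mul0r /of_homog eqxx.
Qed.

(** A projective isomorphism with these three values preserves the cross-ratio,
    which is the identity when it is taken with respect to 0, 1, oo. *)
Lemma normalizerE p0 p1 poo : uniq [:: p0; p1; poo] ->
  normalizer p0 p1 poo = cross_ratio p0 p1 poo.
Proof.
move=> u; rewrite /normalizer.
set P := [set m | _]; have Pcr : P (cross_ratio p0 p1 poo).
  split; first exact: projective_iso_cross_ratio.
  - exact: cross_ratio_0.
  - exact: cross_ratio_1.
  - exact: cross_ratio_oo.
have [mp m0 m1 moo] := getPex (ex_intro P _ Pcr).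
apply: funext => p; have := cross_ratio_projective_iso p0 p1 poo p mp.
by rewrite m0 m1 moo cross_ratio01oo.
Qed.

End CrossRatio.

(** * Convergence on the Riemann sphere *)

Section SphereTopology.
Local Open Scope classical_set_scope.
Variable R : realType.

Lemma real_complex_continuous : continuous (fun x : R => x%:C : R[i]).
Proof.
move=> x; apply/cvgrPdist_lt => /= e e0.
have eE : e = (complex.Re e)%:C by rewrite RRe_real // gtr0_real.
have e0' : 0 < complex.Re e by rewrite -ltcR -eE.
near=> y.
rewrite -rmorphB /= normc_def /= expr0n addr0 sqrtr_sqr eE ltcR.
by near: y; exact: cvgr_dist_lt.
Unshelve. all: by end_near. Qed.

(** Discs lie in compact squares, so that the sets of complex numbers of large
    modulus are punctured neighbourhoods of infinity. *)
Lemma disc_sub_compact (M : R[i]) : exists K : set R[i],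
  [/\ compact K, closed K & forall z, `|z| <= M -> K z].
Proof.
pose r := complex.Re M.
pose f (u : R * R) : R[i] := u.1%:C + 'i * u.2%:C.
pose K := f @` (`[- r, r] `*` `[- r, r]).
have Kc : compact K.
  apply: continuous_compact; last first.
    by apply: compact_setX; exact: segment_compact.
  apply: continuous_subspaceT => u; apply: cvgD.
    by apply: continuous_comp; [exact: cvg_fst|exact: real_complex_continuous].
  apply: cvgM; first exact: cvg_cst.
  by apply: continuous_comp; [exact: cvg_snd|exact: real_complex_continuous].
exists K; split=> //.
  by apply: compact_closed Kc; exact: norm_hausdorff.
move=> z zM.
have ME : M = (complex.Re M)%:C.
  by rewrite RRe_real // ger0_real //; apply: le_trans zM.
exists (complex.Re z, complex.Im z); last by rewrite /f /= [RHS]complexE.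
rewrite /= !in_itv /= -!ler_norml -!(lecR) /r -ME; split.
  exact: le_trans (normc_ge_Re z) zM.
apply: le_trans zM; have := normc_ge_Re ('i * z).
rewrite normrM normCi mul1r.
by case: z {ME} => a b /=; simpc => //=; rewrite normrN.
Qed.

Lemma compact_norm_bounded (K : set R[i]) : compact K ->
  exists n : nat, forall z, K z -> `|z| < n%:R.
Proof.
move=> /compact_near_coveringP/(_ nat \oo (fun n z => `|z| < n%:R) _) Kcov.
suff /Kcov[n _ /(_ n (leqnn n)) nK] :
    forall z, K z -> \forall z' \near z & n \near \oo, `|z'| < n%:R.
  by exists n.
move=> z _.
  have [n zn] : exists n : nat, `|z| + 1 < n%:R.
    exists (Num.bound (complex.Re (`|z| + 1))).
    rewrite -[ltLHS]RRe_real ?ger0_real ?addr_ge0 //.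
    rewrite -(rmorph_nat (real_complex R)) ltcR.
    by apply: archi_boundP; rewrite -lecR RRe_real ?ger0_real ?addr_ge0.
  exists ([set w | `|z - w| < 1], [set m | (n <= m)%N]).
    split; last exact: nbhs_infty_ge.
    exact: (@nbhsx_ballx _ _ z 1 ltr01).
  move=> [w m] /= [zw nm].
  apply: (@le_lt_trans _ _ (`|z| + `|z - w|)).
    by rewrite -[X in `|X| <= _](subKr z) (le_trans (ler_normB _ _)).
  apply: (@lt_le_trans _ _ n%:R); last by rewrite ler_nat.
  by apply: le_lt_trans zn; rewrite lerD2l ltW.
Qed.

Lemma near_dist (T : Type) (F : set_system T) (f : T -> R[i]) (u e : R[i]) :
  Filter F -> f t @[t --> F] --> u -> 0 < e -> \forall t \near F, `|u - f t| < e.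
Proof. by move=> FF fu e0; have /cvgrPdist_lt/(_ e e0) := fu. Qed.

(** Where the denominator tends to 0 the numerator does not, so that the
    quotient leaves every compact set. *)
Lemma cvg_of_homog (T : Type) (F : set_system T) (f g : T -> R[i]) (u v : R[i]) :
  Filter F -> (u != 0) || (v != 0) ->
  f t @[t --> F] --> u -> g t @[t --> F] --> v ->
  of_homog (f t, g t) @[t --> F] --> of_homog (u, v).
Proof.
move=> FF + fu gv; have [v0|v0 _] := eqVneq v 0; rewrite ?orbF.
  move=> u0 U; rewrite {1}/of_homog /= v0 eqxx => -[K [Kc _] KU].
  have [n Kn] := compact_norm_bounded Kc.
  have u2 : 0 < `|u| / 2 by rewrite divr_gt0 ?normr_gt0.
  have un : 0 < `|u| / 2 / n.+1%:R by rewrite divr_gt0 ?ltr0n.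
  have fN := near_dist FF fu u2.
  have gN := near_dist FF gv un.
  rewrite v0 in gN.
  change (\forall t \near F, U (of_homog (f t, g t))).
  apply: filterS2 fN gN => t ft gt.
  apply: KU; rewrite /of_homog /=; case: eqP => [_|/eqP gt0]; first by right.
  left; exists (f t / g t) => // /Kn; rewrite normf_div.
  rewrite ltr_pdivrMr ?normr_gt0 // => fgt.
  move: gt; rewrite sub0r normrN ltr_pdivlMr ?ltr0n // => gt.
  have fu2 : `|f t| < `|u| / 2.
    apply: lt_trans gt; apply: lt_le_trans fgt _.
    by rewrite mulrC ler_wpM2l // ler_nat.
  have : `|u| < `|u| / 2 + `|u| / 2.
    rewrite -{1}(subrK (f t) u) (le_lt_trans (ler_normD _ _)) //.
    exact: ltrD.
  by rewrite -splitr ltxx.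
apply: (@cvg_trans _ ((Some (f t / g t) : sphere R) @[t --> F])).
  apply: near_eq_cvg.
  have v1 : 0 < `|v| by rewrite normr_gt0.
  apply: filterS (near_dist FF gv v1) => t gt.
  rewrite /of_homog /=; case: eqP gt => // ->.
  by rewrite subr0 ltxx.
rewrite /of_homog /= (negPf v0).
have gV : (g t)^-1 @[t --> F] --> v^-1 by exact: cvgV.
have fg : f t / g t @[t --> F] --> u / v by exact: (cvgM fu gV).
exact: (cvg_comp _ _ fg
          (@one_point_compactification_some_continuous R[i] (u / v))).
Qed.

Lemma near_infinity (M : R[i]) (P : set (sphere R)) :
  P None -> (forall z, ~ `|z| <= M -> P (Some z)) ->
  nbhs (None : sphere R) P.
Proof.
move=> Poo PM; have [K [Kc Kcl Kd]] := disc_sub_compact M.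
exists K => // p [[z Kz <-]|->] //.
by apply: PM => /Kd.
Qed.

(** Near each point of the sphere, homogeneous coordinates can be chosen
    continuously; no choice is continuous on the whole sphere. *)
Lemma local_homog (p0 : sphere R) : exists h1 h2 : sphere R -> R[i],
  [/\ h1 p @[p --> p0] --> h1 p0, h2 p @[p --> p0] --> h2 p0 &
   forall p, exists2 k, k != 0 &
     h1 p = k * (homog p).1 /\ h2 p = k * (homog p).2].
Proof.
case: p0 => [w|].
  exists (fun p => (homog p).1), (fun p => (homog p).2); split.
  - by move=> U.
  - move=> U /nbhs_singleton U1.
    change (\forall z \near w, U ((homog (Some z)).2)).
    by apply: filterS filterT.
  - by move=> p; exists 1; rewrite ?mul1r ?oner_eq0.
pose k (p : sphere R) : R[i] :=
  if p is Some z then if z == 0 then 1 else z^-1 else 1.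
exists (fun p => k p * (homog p).1), (fun p => k p * (homog p).2); split.
- move=> U /nbhs_singleton U1.
  apply: (@near_infinity 0) => [//|z z1]; move: U1; rewrite /= !mulr1.
  congr (U _); rewrite /k; case: eqP => [z0|/eqP z0]; last by rewrite mulVf.
  by case: z1; rewrite z0 normr0.
- apply/(@cvgrPdist_lt _ _ _ _ (nbhs_filter (None : sphere R))) => e e0.
  apply: (@near_infinity e^-1) => [|z ze] /=.
    by rewrite subrr normr0.
  rewrite mulr0 sub0r mulr1 normrN.
  case: eqP => [z0|/eqP z0].
    by case: ze; rewrite z0 normr0 invr_ge0 ltW.
  rewrite normfV invf_plt ?posrE ?normr_gt0 //.
  rewrite real_ltNge ?normr_real ?gtr0_real ?invr_gt0 //.
  exact/negP.
- move=> p; exists (k p) => //.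
  case: p => [z|] /=; rewrite ?oner_eq0 //.
  by case: (eqVneq z 0) => [_|z0]; rewrite ?oner_eq0 ?invr_eq0.
Qed.

End SphereTopology.

Section CrossRatioTopology.
Local Open Scope classical_set_scope.
Variable R : realType.
Implicit Types (p q : sphere R) (u v : R[i] * R[i]).

(** [u] is some choice of homogeneous coordinates of [p]. *)
Definition lifts u p : Prop :=
  exists2 k, k != 0 & u = (k * (homog p).1, k * (homog p).2).

Lemma lifts_cvg (T : Type) (F : set_system T) (f : T -> sphere R) p :
  Filter F -> f t @[t --> F] --> p ->
  exists (h : T -> R[i] * R[i]) u, [/\ forall t, lifts (h t) (f t), lifts u p,
    (h t).1 @[t --> F] --> u.1 & (h t).2 @[t --> F] --> u.2].
Proof.
move=> FF fp; have [h1 [h2 [c1 c2 h12]]] := local_homog p.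
have hK q : lifts (h1 q, h2 q) q by have [k k0 [-> ->]] := h12 q; exists k.
exists (fun t => (h1 (f t), h2 (f t))), (h1 p, h2 p).
split.
- by move=> t; exact: hK.
- exact: hK.
- exact: (cvg_comp _ _ fp c1).
- exact: (cvg_comp _ _ fp c2).
Qed.

Lemma cvg_wedge (T : Type) (F : set_system T) (h h' : T -> R[i] * R[i]) u v :
  Filter F -> (h t).1 @[t --> F] --> u.1 -> (h t).2 @[t --> F] --> u.2 ->
  (h' t).1 @[t --> F] --> v.1 -> (h' t).2 @[t --> F] --> v.2 ->
  wedge (h t) (h' t) @[t --> F] --> wedge u v.
Proof.
move=> FF u1 u2 v1 v2.
exact: (cvgB (cvgM u1 v2) (cvgM u2 v1)).
Qed.

(** Lifted to continuous homogeneous coordinates, the cross-ratio is a pair of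
    polynomials without common zero as long as the first three points are
    distinct. *)
Lemma cvg_cross_ratio (T : Type) (F : set_system T) (f0 f1 foo f : T -> sphere R)
    p0 p1 poo p :
  Filter F -> uniq [:: p0; p1; poo] ->
  f0 t @[t --> F] --> p0 -> f1 t @[t --> F] --> p1 ->
  foo t @[t --> F] --> poo -> f t @[t --> F] --> p ->
  cross_ratio (f0 t) (f1 t) (foo t) (f t) @[t --> F] -->
  cross_ratio p0 p1 poo p.
Proof.
move=> FF u /(lifts_cvg FF)[h0 [u0 [l0 L0 c0 c0']]].
move=> /(lifts_cvg FF)[h1 [u1 [l1 L1 c1 c1']]].
move=> /(lifts_cvg FF)[h2 [u2 [l2 L2 c2 c2']]].
move=> /(lifts_cvg FF)[h3 [u3 [l3 L3 c3 c3']]].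
have crE v0 v1 voo v q0 q1 qoo q :
    lifts v0 q0 -> lifts v1 q1 -> lifts voo qoo -> lifts v q ->
    cross_ratio q0 q1 qoo q =
    of_homog (wedge v v0 * wedge voo v1, wedge v voo * wedge v0 v1).
  move=> [k0 k00 ->] [k1 k10 ->] [k2 k20 ->] [k k_0 ->].
  have kk0 : k * k0 * k2 * k1 != 0 by rewrite !mulf_neq0.
  rewrite /cross_ratio -(of_homogZ _ _ kk0).
  by congr (of_homog (_, _)); rewrite /bracket /wedge /=; ring.
rewrite (crE _ _ _ _ _ _ _ _ L0 L1 L2 L3).
under eq_fun do rewrite (crE _ _ _ _ _ _ _ _ (l0 _) (l1 _) (l2 _) (l3 _)).
apply: cvg_of_homog; last 2 first.
- by apply: cvgM; exact: cvg_wedge.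
- by apply: cvgM; exact: cvg_wedge.
have wedge_neq0 v v' q q' : lifts v q -> lifts v' q' -> q != q' -> wedge v v' != 0.
  move=> [k k0 ->] [k' k'0 ->] qq'.
  have -> : wedge (k * (homog q).1, k * (homog q).2)
      (k' * (homog q').1, k' * (homog q').2) = k * k' * bracket q q'.
    by rewrite /bracket /wedge /=; ring.
  by rewrite !mulf_neq0 // bracket_eq0.
move: u; rewrite /= !inE negb_or andbT => /andP[/andP[n01 n02] n12].
have [pp0|pp0] := eqVneq p p0; apply/orP; [right|left]; apply: mulf_neq0.
- by apply: wedge_neq0 L3 L2 _; rewrite pp0.
- exact: wedge_neq0 L0 L1 _.
- exact: wedge_neq0 L3 L0 _.
- by apply: wedge_neq0 L2 L1 _; rewrite eq_sym.
Qed.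

(** Equality of the cross-ratios of two quadruples of points, cleared of
    denominators: it is multihomogeneous, and still makes sense, possibly
    without content, when some of the points collide. *)
Definition same_cross_ratio (p1 p2 p3 p4 q1 q2 q3 q4 : sphere R) : Prop :=
  bracket p1 p2 * bracket p3 p4 * (bracket q1 q3 * bracket q2 q4) =
  bracket q1 q2 * bracket q3 q4 * (bracket p1 p3 * bracket p2 p4).

Lemma same_cross_ratio_projective_iso m m' p1 p2 p3 p4 :
  projective_iso m -> projective_iso m' ->
  same_cross_ratio (m p1) (m p2) (m p3) (m p4) (m' p1) (m' p2) (m' p3) (m' p4).
Proof.
move=> /bracket_projective_iso[d [k [d0 k0 e]]].
move=> /bracket_projective_iso[d' [k' [d0' k0' e']]].
rewrite /same_cross_ratio.
have K0 : (k p1 * k p2 * k p3 * k p4) * (k' p1 * k' p2 * k' p3 * k' p4) != 0.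
  by rewrite !mulf_neq0.
apply: (mulfI K0).
transitivity (((k p1 * k p2 * bracket (m p1) (m p2)) *
               (k p3 * k p4 * bracket (m p3) (m p4))) *
              ((k' p1 * k' p3 * bracket (m' p1) (m' p3)) *
               (k' p2 * k' p4 * bracket (m' p2) (m' p4)))); first by ring.
transitivity (((k' p1 * k' p2 * bracket (m' p1) (m' p2)) *
               (k' p3 * k' p4 * bracket (m' p3) (m' p4))) *
              ((k p1 * k p3 * bracket (m p1) (m p3)) *
               (k p2 * k p4 * bracket (m p2) (m p4)))); last by ring.
by rewrite -!e -!e'; ring.
Qed.

(** By multihomogeneity the points can be replaced by continuous lifts, for
    which the identity is polynomial. *)
Lemma same_cross_ratio_cvg (T : Type) (F : set_system T)
    (f1 f2 f3 f4 g1 g2 g3 g4 : T -> sphere R) p1 p2 p3 p4 q1 q2 q3 q4 :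
  ProperFilter F ->
  f1 t @[t --> F] --> p1 -> f2 t @[t --> F] --> p2 ->
  f3 t @[t --> F] --> p3 -> f4 t @[t --> F] --> p4 ->
  g1 t @[t --> F] --> q1 -> g2 t @[t --> F] --> q2 ->
  g3 t @[t --> F] --> q3 -> g4 t @[t --> F] --> q4 ->
  (\forall t \near F, same_cross_ratio (f1 t) (f2 t) (f3 t) (f4 t)
                                       (g1 t) (g2 t) (g3 t) (g4 t)) ->
  same_cross_ratio p1 p2 p3 p4 q1 q2 q3 q4.
Proof.
move=> FF /lifts_cvg[h1 [u1 [l1 L1 c1 c1']]].
move=> /lifts_cvg[h2 [u2 [l2 L2 c2 c2']]].
move=> /lifts_cvg[h3 [u3 [l3 L3 c3 c3']]].
move=> /lifts_cvg[h4 [u4 [l4 L4 c4 c4']]].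
move=> /lifts_cvg[k1 [v1 [m1 M1 d1 d1']]].
move=> /lifts_cvg[k2 [v2 [m2 M2 d2 d2']]].
move=> /lifts_cvg[k3 [v3 [m3 M3 d3 d3']]].
move=> /lifts_cvg[k4 [v4 [m4 M4 d4 d4']]].
pose poly (w1 w2 w3 w4 x1 x2 x3 x4 : R[i] * R[i]) :=
  wedge w1 w2 * wedge w3 w4 * (wedge x1 x3 * wedge x2 x4) -
  wedge x1 x2 * wedge x3 x4 * (wedge w1 w3 * wedge w2 w4).
have polyE w1 w2 w3 w4 x1 x2 x3 x4 r1 r2 r3 r4 s1 s2 s3 s4 :
    lifts w1 r1 -> lifts w2 r2 -> lifts w3 r3 -> lifts w4 r4 ->
    lifts x1 s1 -> lifts x2 s2 -> lifts x3 s3 -> lifts x4 s4 ->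
    same_cross_ratio r1 r2 r3 r4 s1 s2 s3 s4 <-> poly w1 w2 w3 w4 x1 x2 x3 x4 = 0.
  move=> [a1 a10 ->] [a2 a20 ->] [a3 a30 ->] [a4 a40 ->].
  move=> [b1 b10 ->] [b2 b20 ->] [b3 b30 ->] [b4 b40 ->].
  have A0 : a1 * a2 * a3 * a4 * (b1 * b2 * b3 * b4) != 0 by rewrite !mulf_neq0.
  rewrite /poly; set lhs := _ - _; have -> : lhs =
    (a1 * a2 * a3 * a4 * (b1 * b2 * b3 * b4)) *
    (bracket r1 r2 * bracket r3 r4 * (bracket s1 s3 * bracket s2 s4) -
     bracket s1 s2 * bracket s3 s4 * (bracket r1 r3 * bracket r2 r4)).
    by rewrite /lhs /bracket /wedge /=; ring.
  split=> [->|/eqP]; first by rewrite subrr mulr0.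
  by rewrite mulf_eq0 (negPf A0) subr_eq0 => /eqP.
move=> near_same; apply/(polyE _ _ _ _ _ _ _ _ _ _ _ _ _ _ _ _
  L1 L2 L3 L4 M1 M2 M3 M4).
have cpoly : poly (h1 t) (h2 t) (h3 t) (h4 t) (k1 t) (k2 t) (k3 t) (k4 t)
    @[t --> F] --> poly u1 u2 u3 u4 v1 v2 v3 v4.
  by apply: cvgB; apply: cvgM; apply: cvgM; exact: cvg_wedge.
apply: (cvg_unique (@norm_hausdorff _ R[i]) cpoly).
apply: cvg_near_cst; apply: filterS near_same => t.
exact: (iffLR (polyE _ _ _ _ _ _ _ _ _ _ _ _ _ _ _ _
  (l1 t) (l2 t) (l3 t) (l4 t) (m1 t) (m2 t) (m3 t) (m4 t))).
Qed.

End CrossRatioTopology.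

(** * Branches of a combinatorial tree *)

Section Branches.
Variables (E : finType) (T : comb_tree E).
Implicit Types (u v w s : vertex E T) (x y z : E).

Let away u := [rel p q : vertex E T | [&& adj p q, p != u & q != u]].

Lemma same_component_refl u w : w != u -> same_component u w w.
Proof. by rewrite /same_component => ->; rewrite connect0. Qed.

Lemma same_component_sym u w s : same_component u w s = same_component u s w.
Proof.
rewrite /same_component [LHS]andbCA; congr (_ && (_ && _)).
apply: (@sym_connect_sym _ (away u)) => p q /=.
by rewrite (@adj_sym _ T) [X in _ && X]andbC.
Qed.

Lemma same_component_trans u w s t :
  same_component u w s -> same_component u s t -> same_component u w t.
Proof.
rewrite /same_component => /and3P[-> su ws] /and3P[_ -> st] /=.
exact: connect_trans st.
Qed.

Lemma same_component_path u w p :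
  path (@adj _ T) w p -> u \notin w :: p -> same_component u w (last w p).
Proof.
move=> wp unp; have avoid t : t \in w :: p -> t != u.
  by move=> twp; apply: contraNneq unp => <-.
apply/and3P; split; [exact/avoid/mem_head|exact/avoid/mem_last|].
apply/connectP; exists p => //.
apply: (sub_in_path (P := predC1 u)) wp => [a b|].
  by rewrite !inE /= => -> -> ->.
by apply/allP => t /avoid.
Qed.

Lemma path_away u w p : path (away u) w p -> path (@adj _ T) w p /\ u \notin p.
Proof.
elim: p w => //= n p IH w /andP[/and3P[-> _ nu] /IH[-> up]].
by rewrite inE negb_or eq_sym nu.
Qed.

Lemma uniq_pathP u w : exists p, [/\ path (@adj _ T) u p, uniq (u :: p) & w = last u p].
Proof.
have /connectP[p up ->] := tree_connected u w.
by have [q uq uuq _] := shortenP up; exists q.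
Qed.

Lemma component_neighbor u w : w != u ->
  exists2 n, adj u n & same_component u n w.
Proof.
have [[|n p] [/= up uup ->]] := uniq_pathP u w; first by rewrite eqxx.
case/andP: up => un np _; exists n => //.
by apply: same_component_path np _; case/andP: uup.
Qed.

(** Two neighbours in one component would close a cycle through [u]. *)
Lemma neighbors_separated u n n' : adj u n -> adj u n' -> n != n' ->
  ~~ same_component u n n'.
Proof.
move=> un un' nn'; apply/negP => /and3P[nu n'u /connectP[p0 np0 n'E]].
move: n'E; have [p /path_away[np up] unp _] := shortenP np0 => n'E.
have : ucycle (@adj _ T) (u :: n :: p).
  apply/andP; split; last first.
    by rewrite cons_uniq unp inE negb_or eq_sym nu up.
  by rewrite /= un rcons_path np -n'E adj_sym.
by move/tree_acyclic; case: p n'E {np unp up} nn' => //= <-; rewrite eqxx.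
Qed.

(** A simple path from [u] to [w] avoids [v], or avoids [u] from [v] on. *)
Lemma beyond_either u v w : u != v -> w != u -> w != v ->
  same_component u v w || same_component v u w.
Proof.
move=> uv wu wv; have [p [up uup wE]] := uniq_pathP u w.
have [vp|vp] := boolP (v \in p); last first.
  apply/orP; right; rewrite wE; apply: same_component_path => //.
  by rewrite inE negb_or eq_sym uv.
apply/orP; left; case/splitPr: vp up uup wE => p1 p2.
rewrite cat_path /= last_cat /= mem_cat !inE !negb_or.
move=> /and3P[_ _ vp2] /andP[/and3P[_ uv' up2] _] ->.
by apply: same_component_path => //; rewrite inE negb_or uv'.
Qed.

(** A simple path from [v] to [s] that avoids [w] would leave [v] through a
    second neighbour in the component of [w]. *)
Lemma edge_sides v w s : adj v w -> same_component v w s -> ~~ same_component w v s.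
Proof.
move=> vw vws; apply/negP => /and3P[vw' sw /connectP[p0 vp0 sE]].
move: sE; have [[|n p] /path_away[vp wp] uvp _] := shortenP vp0 => sE.
  by move: vws; rewrite sE /same_component /= eqxx andbF.
move: vp wp uvp => /= /andP[vn np]; rewrite inE negb_or => /andP[wn wp].
move=> /andP[vnp _]; suff : same_component v w n by exact/negP/neighbors_separated.
apply: same_component_trans vws _; rewrite same_component_sym sE.
exact: same_component_path.
Qed.

Lemma leaf_neighbor x u w : adj (inl x) u -> adj (inl x) w -> u = w.
Proof.
have /mem_card1[n xE] := leaf_valence T x.
have xn w' : adj (inl x) w' -> w' = n.
  by move=> xw'; apply/eqP; rewrite -[_ == _]/(w' \in pred1 n) -xE.
by move=> /xn -> /xn ->.
Qed.

Lemma leaf_component x u s : adj u (inl x) -> same_component u (inl x) s ->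
  s = inl x.
Proof.
move=> ux /and3P[_ _ /connectP[[|n p] //= /andP[/and3P[xn _ nu] _] _]].
by rewrite adj_sym in ux; rewrite (leaf_neighbor ux xn) eqxx in nu.
Qed.

End Branches.

(** * Medians and attaching points *)

Section Median.
Variables (E : finType) (T : comb_tree E).
Implicit Types (v w : 'I_(internal T)) (x y : E).

(** If a vertex beside [x0] sees two of the leaves in one branch, then so does
    its neighbour in that branch, with a larger component around [x0]; a vertex
    with the largest component is therefore the median. *)
Lemma separates_exists x0 x1 xoo : uniq [:: x0; x1; xoo] ->
  exists v, separates v x0 x1 xoo.
Proof.
rewrite /= !inE negb_or andbT => /andP[/andP[n01 n0oo] n1oo].
have n10 : inl x1 != inl x0 :> vertex E T by rewrite eq_sym in n01.
have noo0 : inl xoo != inl x0 :> vertex E T by rewrite eq_sym in n0oo.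
pose cut v := ~~ same_component (inr v) (inl x0) (inl x1) &&
              ~~ same_component (inr v) (inl x0) (inl xoo).
have [v0 cut0] : exists v, cut v.
  have [[z|v0] x0n c1] := component_neighbor n10.
    have [n x0n' coo] := component_neighbor noo0.
    have nE := leaf_neighbor x0n x0n'; rewrite -{}nE {x0n'} in coo.
    have [e1] := leaf_component x0n c1; have [eoo] := leaf_component x0n coo.
    by rewrite e1 eoo eqxx in n1oo.
  exists v0; rewrite adj_sym in x0n; apply/andP; split; apply/negP.
    by move=> /(leaf_component x0n)[e]; rewrite e eqxx in n01.
  by move=> /(leaf_component x0n)[e]; rewrite e eqxx in n0oo.
pose m v := #|[pred s | same_component (inr v) (inl x0) s]|.
case: (@arg_maxnP _ v0 cut m cut0) => v /andP[c01 c0oo] vmax.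
exists v; rewrite /separates c01 c0oo andbT /=; apply/negP => c1oo.
have [w vw wx1] := @component_neighbor _ T (inr v) (inl x1) isT.
have wxoo := same_component_trans wx1 c1oo.
case: w vw wx1 wxoo => [z|w] vw wx1 wxoo.
  have [e1] := leaf_component vw wx1; have [eoo] := leaf_component vw wxoo.
  by rewrite e1 eoo eqxx in n1oo.
have vw' : inr v != inr w :> vertex E T.
  by apply: contraTneq vw => ->; rewrite adj_irr.
have x0v : same_component (inr w) (inl x0) (inr v).
  have := @beyond_either _ T (inr v) (inr w) (inl x0) vw' isT isT.
  rewrite [X in _ || X]same_component_sym => /orP[c|//]; case/negP: c01.
  by rewrite same_component_sym in c; exact: same_component_trans wx1.
have cutw : cut w.
  apply/andP; split; apply/negP => c.
    case/negP: (edge_sides vw wx1).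
    by apply: same_component_trans c; rewrite same_component_sym.
  case/negP: (edge_sides vw wxoo).
  by apply: same_component_trans c; rewrite same_component_sym.
suff : (m v < m w)%N by rewrite ltnNge => /negP[]; exact: vmax cutw.
apply: proper_card; apply/properP; split; last first.
  by exists (inr v); rewrite !inE // /same_component eqxx.
apply/fintype.subsetP => s; rewrite !inE => c.
apply: same_component_trans x0v _.
have sv : s != inr v by case/and3P: c.
have nws : ~~ same_component (inr v) (inr w) s.
  apply/negP; rewrite same_component_sym => c'; case/negP: c01.
  exact: same_component_trans (same_component_trans c c') wx1.
have sw : s != inr w.
  by apply: contraNneq nws => ->; rewrite same_component_refl // eq_sym.
by have := beyond_either vw' sv sw; rewrite (negPf nws).
Qed.

End Median.

Section AttachingPoints.
Variables (R : realType) (E : finType).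
Implicit Types (T : sphere_tree R E) (x y : E).

(** Extends [attach_leaf], its value at the leaves, to internal vertices: the
    direction of one vertex seen from another is what relates their spheres. *)
Definition branch T (v : 'I_(internal (shape T))) (s : vertex E (shape T)) :
    sphere R :=
  if [pick w | adj (inr v) w && same_component (inr v) w s] is Some w
  then attach v w else None.

Lemma branch_attach T (v : 'I_(internal (shape T))) w s :
  adj (inr v) w -> same_component (inr v) w s -> branch v s = attach v w.
Proof.
move=> vw ws; rewrite /branch; case: pickP => [w'|/(_ w)]; last by rewrite vw ws.
move=> /andP[vw' ws'].
have [->//|ww'] := eqVneq w' w.
case/negP: (neighbors_separated vw' vw ww').
by apply: same_component_trans ws' _; rewrite same_component_sym.
Qed.

Lemma eq_branch T (v : 'I_(internal (shape T))) s s' :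
  s != inr v -> s' != inr v ->
  (branch v s == branch v s') = same_component (inr v) s s'.
Proof.
move=> sv s'v; have [w vw ws] := component_neighbor sv.
have [w' vw' ws'] := component_neighbor s'v.
rewrite (branch_attach vw ws) (branch_attach vw' ws').
apply/eqP/idP => [/(attach_inj vw vw') ww'|ss'].
  by rewrite same_component_sym in ws; apply: same_component_trans ws _; rewrite ww'.
rewrite -(branch_attach vw ws) -(branch_attach vw' ws') (branch_attach vw' ws').
apply: branch_attach => //; apply: same_component_trans ws' _.
by rewrite same_component_sym.
Qed.

Lemma eq_attach_leaf T (v : 'I_(internal (shape T))) x y :
  (attach_leaf v x == attach_leaf v y) =
  same_component (inr v) (inl x) (inl y).
Proof. exact: eq_branch. Qed.

Lemma separatesE T (v : 'I_(internal (shape T))) x0 x1 xoo :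
  separates v x0 x1 xoo =
  uniq [:: attach_leaf v x0; attach_leaf v x1; attach_leaf v xoo].
Proof.
rewrite /= !inE negb_or !eq_attach_leaf andbT /separates.
by rewrite -andbA; congr (_ && _); rewrite andbC.
Qed.

(** This is the degenerate relation between the spheres of two vertices: its
    centre and its value are the directions of the vertices from each other. *)
Lemma branch_either T (v w : 'I_(internal (shape T))) x : v != w ->
  attach_leaf v x = branch v (inr w) \/ attach_leaf w x = branch w (inr v).
Proof.
move=> vw; have /orP[c|c] := @beyond_either _ _ (inr v) (inr w) (inl x) vw isT isT.
- left; apply/eqP; rewrite [_ == _]eq_branch 1?same_component_sym //.
  by rewrite eq_sym in vw.
- by right; apply/eqP; rewrite [_ == _]eq_branch 1?same_component_sym.
Qed.

(** Of three leaves in different branches at [v], two are not in the branch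
    towards [w]; as seen from [w] they are both in the branch towards [v]. *)
Lemma separates_unique T (v w : 'I_(internal (shape T))) x0 x1 xoo :
  separates v x0 x1 xoo -> separates w x0 x1 xoo -> v = w.
Proof.
rewrite !separatesE /= !inE !negb_or !andbT.
move=> /andP[/andP[v01 v0oo] v1oo] /andP[/andP[w01 w0oo] w1oo].
apply/eqP; apply: contraT => vw.
have := branch_either x0 vw; have := branch_either x1 vw.
have := branch_either xoo vw.
move: v01 v0oo v1oo w01 w0oo w1oo.
by move=> /eqP v01 /eqP v0oo /eqP v1oo /eqP w01 /eqP w0oo /eqP w1oo [|] e1 [|] e2 [|] e3;
  congruence.
Qed.

Lemma medianE T (v : 'I_(internal (shape T))) x0 x1 xoo :
  separates v x0 x1 xoo -> median (shape T) x0 x1 xoo = Some v.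
Proof.
move=> sv; rewrite /median; case: pickP => [w sw|/(_ v)]; last by rewrite sv.
by rewrite (separates_unique sv sw).
Qed.

Lemma alphaE T (v : 'I_(internal (shape T))) x0 x1 xoo x :
  separates v x0 x1 xoo ->
  alpha T x0 x1 xoo x = cross_ratio (attach_leaf v x0) (attach_leaf v x1)
                                    (attach_leaf v xoo) (attach_leaf v x).
Proof.
by move=> sv; rewrite /alpha (medianE sv) normalizerE // -separatesE.
Qed.

(** An isomorphism maps the branch of a leaf at [v] into the branch of this leaf
    at the image of [v]. *)
Lemma alpha_iso T1 T2 x0 x1 xoo x : sphere_tree_iso T1 T2 ->
  uniq [:: x0; x1; xoo] -> alpha T1 x0 x1 xoo x = alpha T2 x0 x1 xoo x.
Proof.
move=> [f [m [bf fadj mp mattach]]] u.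
have f_inj := bij_inj bf.
have F_inj : injective (vertex_map (E := E) f).
  by move=> [a|a] [b|b] //=; [move=> [->]|move=> [/f_inj ->]].
have attachE v y : attach_leaf (f v) y = m v (attach_leaf v y).
  have [w vw wy] := @component_neighbor _ (shape T1) (inr v) (inl y) isT.
  rewrite -[attach_leaf v y]/(branch v (inl y)) (branch_attach vw wy) mattach //.
  apply: branch_attach; first by rewrite -[inr (f v)]/(vertex_map f (inr v)) fadj.
  case/and3P: wy => wv _ /connectP[p wp yE].
  apply/and3P; split=> //.
    by rewrite -[inr (f v)]/(vertex_map f (inr v)) (inj_eq F_inj).
  apply/connectP; exists (map (vertex_map f) p); last first.
    by rewrite last_map -yE.
  rewrite path_map; apply: sub_path wp => a b /= /and3P[ab av bv].
  by rewrite fadj ab -[inr (f v)]/(vertex_map f (inr v)) !(inj_eq F_inj) av.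
have [v sv] := separates_exists (shape T1) u.
have sfv : separates (f v) x0 x1 xoo.
  rewrite separatesE !attachE -[[:: _; _; _]]/(map (m v) [:: _; _; _]).
  by rewrite map_inj_uniq -?separatesE //; exact: projective_iso_inj.
by rewrite (alphaE _ sv) (alphaE _ sfv) !attachE cross_ratio_projective_iso.
Qed.

End AttachingPoints.

(** * Coherent families and hierarchies of clusters *)

Section Coherent.
Variables (R : realType) (E : finType).
Implicit Types (A : E -> E -> E -> E -> sphere R) (x y : E).

(** Two of the maps [A x0 x1 xoo] of a coherent family either differ by a
    Moebius map, or are related by a limit of Moebius maps of rank one, which
    sends everything but its centre [p] to one point [q]. *)
Record coherent A : Prop := Coherent {
  coherent_norm : forall x0 x1 xoo, uniq [:: x0; x1; xoo] ->
    [/\ A x0 x1 xoo x0 = Some 0, A x0 x1 xoo x1 = Some 1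
      & A x0 x1 xoo xoo = None];
  coherent_iso : forall x0 x1 xoo y0 y1 yoo x,
    uniq [:: x0; x1; xoo] -> uniq [:: y0; y1; yoo] ->
    uniq [:: A x0 x1 xoo y0; A x0 x1 xoo y1; A x0 x1 xoo yoo] ->
    A y0 y1 yoo x = cross_ratio (A x0 x1 xoo y0) (A x0 x1 xoo y1)
                                (A x0 x1 xoo yoo) (A x0 x1 xoo x);
  coherent_degenerate : forall x0 x1 xoo y0 y1 yoo,
    uniq [:: x0; x1; xoo] -> uniq [:: y0; y1; yoo] ->
    ~~ uniq [:: A x0 x1 xoo y0; A x0 x1 xoo y1; A x0 x1 xoo yoo] ->
    exists p q, forall x, A x0 x1 xoo x = p \/ A y0 y1 yoo x = q }.

(** The two cases are those of equal and of distinct medians. *)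
Lemma alpha_coherent (T : sphere_tree R E) : coherent (alpha T).
Proof.
split=> [x0 x1 xoo|x0 x1 xoo y0 y1 yoo x|x0 x1 xoo y0 y1 yoo];
  move=> /(separates_exists (shape T))[v sv]; have uv := sv; rewrite separatesE in uv.
- by rewrite !(alphaE _ sv) cross_ratio_0 // cross_ratio_1 // cross_ratio_oo.
- move=> _; have pv := projective_iso_cross_ratio uv.
  rewrite !(alphaE _ sv) -[[:: _; _; _]]/(map (cross_ratio _ _ _) [:: _; _; _]).
  rewrite (map_inj_uniq (projective_iso_inj pv)) -separatesE => sv'.
  by rewrite (alphaE _ sv') cross_ratio_projective_iso.
- move=> /(separates_exists (shape T))[w sw] nu.
  have uw := sw; rewrite separatesE in uw.
  have vw : v != w.
    apply: contraNneq nu => vw; rewrite !(alphaE _ sv).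
    rewrite -[[:: _; _; _]]/(map (cross_ratio _ _ _) [:: _; _; _]) map_inj_uniq.
      by rewrite vw.
    exact/projective_iso_inj/projective_iso_cross_ratio.
  exists (cross_ratio (attach_leaf v x0) (attach_leaf v x1)
                      (attach_leaf v xoo) (branch v (inr w))).
  exists (cross_ratio (attach_leaf w y0) (attach_leaf w y1)
                      (attach_leaf w yoo) (branch w (inr v))).
  move=> x; rewrite (alphaE _ sv) (alphaE _ sw).
  by have [->|->] := branch_either x vw; [left|right].
Qed.

(** A tree of spheres seen from the leaf [r] placed at infinity: an internal
    vertex is the cluster of the leaves that it separates from [r], and
    [coord C] gives the attaching points of these leaves on its sphere, where
    the branch of [r] is attached at infinity. *)
Record hierarchy (r : E) := Hierarchy {
  clusters : {set {set E}};
  coord : {set E} -> E -> R[i];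
  clusters_top : [set~ r] \in clusters;
  clusters_root : forall C, C \in clusters -> r \notin C;
  clusters_laminar : forall C D x, C \in clusters -> D \in clusters ->
    x \in C -> x \in D -> C \subset D \/ D \subset C;
  coord_const : forall C D x y, C \in clusters -> D \in clusters ->
    D \proper C -> x \in D -> y \in D -> coord C x = coord C y;
  coord_split : forall C x y, C \in clusters -> x \in C -> y \in C -> x != y ->
    coord C x = coord C y ->
    exists2 D, D \in clusters & [/\ D \proper C, x \in D & y \in D];
  coord_two : forall C, C \in clusters ->
    exists x y, [/\ x \in C, y \in C & coord C x != coord C y] }.

Definition place r (H : hierarchy r) (C : {set E}) x : sphere R :=
  if x \in C then Some (coord H C x) else None.

(** The cluster [C] plays the part of the median of [x0], [x1], [xoo]. *)
Definition realizes r (H : hierarchy r) A : Prop :=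
  forall x0 x1 xoo, uniq [:: x0; x1; xoo] ->
  exists2 C, C \in clusters H &
    uniq [:: place H C x0; place H C x1; place H C xoo] /\
    forall x, A x0 x1 xoo x = cross_ratio (place H C x0) (place H C x1)
                                          (place H C xoo) (place H C x).

Section FromCoherent.
Variables (A : E -> E -> E -> E -> sphere R) (r : E).
Hypothesis cA : coherent A.
Implicit Types (u v w z : E).

Let basis x y := uniq [:: x; y; r].
Let a x y z := A x y r z.

Let a_norm x y : basis x y ->
  [/\ a x y x = Some 0, a x y y = Some 1 & a x y r = None].
Proof. exact: (coherent_norm cA). Qed.

Let a_inj x y u v : basis x y -> basis u v -> a x y u != a x y v ->
  a x y u != None -> a x y v != None ->
  forall w, a u v w = cross_ratio (a x y u) (a x y v) None (a x y w).
Proof.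
move=> xy uv auv au av w; have [_ _ ar] := a_norm xy.
rewrite -ar; apply: (coherent_iso cA) => //.
by rewrite [A x y r r]ar /= !inE negb_or auv au av.
Qed.

(** [u] and [v] have collided at the scale of [x] and [y]: what stays at
    finite distance at the scale of [u] and [v] has collided with them. *)
Let a_collide x y u v : basis x y -> basis u v -> a x y u = a x y v ->
  a x y u != None -> forall w, a x y w = a x y u \/ a u v w = None.
Proof.
move=> xy uv auv /eqP au.
have [_ _ ar] := a_norm xy; have [u0 v1 roo] := a_norm uv.
have [|p [q pq]] := coherent_degenerate cA xy uv.
  by rewrite -/(a x y u) -/(a x y v) auv /= inE eqxx.
have up : a x y u = p.
  have [//|qu] := pq u; have [vp|qv] := pq v; first by rewrite auv.
  have : Some 1 = Some 0 :> sphere R by rewrite -u0 -v1 /a qu qv.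
  by move=> -[/eqP]; rewrite oner_eq0.
have qoo : None = q.
  have [rp|<-] := pq r; last by rewrite -roo.
  by case: au; rewrite up -rp -ar.
by move=> w; rewrite up qoo; exact: pq.
Qed.

(** [u] or [v] is out of reach at the scale of [x] and [y]: all that is
    within reach has collided at the scale of [u] and [v]. *)
Let a_escape x y u v : basis x y -> basis u v ->
  a x y u = None \/ a x y v = None ->
  exists q, forall w, a x y w = None \/ a u v w = q.
Proof.
move=> xy uv auv.
have [_ _ ar] := a_norm xy; have [u0 v1 roo] := a_norm uv.
have [|p [q pq]] := coherent_degenerate cA xy uv.
  rewrite -/(a x y u) -/(a x y v) -/(a x y r) ar /= !inE.
  by case: auv => ->; rewrite ?eqxx ?orbT ?andbF.
have poo : p = None.
  have [rp|rq] := pq r; first by rewrite -rp -ar.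
  have up : a x y u = p.
    by have [//|qu] := pq u; move: (u0); rewrite /a qu -rq -/(a u v r) roo.
  have vp : a x y v = p.
    by have [//|qv] := pq v; move: (v1); rewrite /a qv -rq -/(a u v r) roo.
  by rewrite -up; case: auv; [|rewrite up -vp].
by exists q => w; rewrite -poo; exact: pq.
Qed.

(** The cluster of the median of [x], [y] and [r]: what stays at finite distance
    when [x] and [y] are put at 0 and 1. *)
Let ball x y := [set z | a x y z != None].

Let in_ball x y z : (z \in ball x y) = (a x y z != None).
Proof. by rewrite inE. Qed.

Let ball_inj x y u v : basis x y -> basis u v -> a x y u != a x y v ->
  u \in ball x y -> v \in ball x y -> ball u v = ball x y.
Proof.
move=> xy uv auv; rewrite !in_ball => au av; apply/setP => w; rewrite !in_ball.
have cr : uniq [:: a x y u; a x y v; None] by rewrite /= !inE negb_or auv au av.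
have inj := projective_iso_inj (projective_iso_cross_ratio cr).
by rewrite (a_inj xy uv auv au av) -[in RHS](inj_eq inj) cross_ratio_oo.
Qed.

Let ball_collide x y u v : basis x y -> basis u v -> a x y u = a x y v ->
  u \in ball x y ->
  (forall w, w \in ball u v -> a x y w = a x y u) /\ ball u v \proper ball x y.
Proof.
move=> xy uv auv; rewrite in_ball => au.
have sub w : w \in ball u v -> a x y w = a x y u.
  by rewrite in_ball => /eqP auvw; have [] := a_collide xy uv auv au w.
split=> //; apply/properP; split.
  by apply/fintype.subsetP => w /sub awu; rewrite in_ball awu.
have [ax ay _] := a_norm xy; have [ux|ux] := eqVneq (a x y u) (Some 0).
  exists y; first by rewrite in_ball ay.
  apply/negP => /sub; rewrite ay ux => -[/eqP].
  by rewrite oner_eq0.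
exists x; first by rewrite in_ball ax.
by apply/negP => /sub; rewrite ax => /esym/eqP; rewrite (negPf ux).
Qed.

(** If [u] or [v] is outside the ball of [x] and [y], all of this ball has
    collided at the scale of [u] and [v], at a finite point because of [w]. *)
Let ball_laminar x y u v w : basis x y -> basis u v ->
  w \in ball x y -> w \in ball u v ->
  ball x y \subset ball u v \/ ball u v \subset ball x y.
Proof.
move=> xy uv wxy wuv.
have [uB|uB] := boolP (u \in ball x y); last first.
  left; have [|q qE] := a_escape xy uv.
    by left; apply/eqP; rewrite in_ball negbK in uB.
  apply/fintype.subsetP => z; rewrite !in_ball in wxy wuv * => /eqP axy.
  have [//|->] := qE z; have [e|<- //] := qE w.
  by rewrite e eqxx in wxy.
have [vB|vB] := boolP (v \in ball x y); last first.
  left; have [|q qE] := a_escape xy uv.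
    by right; apply/eqP; rewrite in_ball negbK in vB.
  apply/fintype.subsetP => z; rewrite !in_ball in wxy wuv * => /eqP axy.
  have [//|->] := qE z; have [e|<- //] := qE w.
  by rewrite e eqxx in wxy.
right; have [auv|auv] := eqVneq (a x y u) (a x y v).
  by have [_ /proper_sub] := ball_collide xy uv auv uB.
by rewrite (ball_inj xy uv auv uB vB).
Qed.

Let balls := [set ball p.1 p.2 | p : E * E & basis p.1 p.2].

(** The sphere of a ball needs one affine coordinate, hence the choice of one
    pair of leaves for each ball. *)
Let center C : E * E :=
  odflt (r, r) [pick p | basis p.1 p.2 && (ball p.1 p.2 == C)].

Let affine C x : R[i] := odflt 0 (a (center C).1 (center C).2 x).

Let ballsP C : C \in balls ->
  exists u v, [/\ basis u v, C = ball u v &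
    forall z, z \in C -> a u v z = Some (affine C z)].
Proof.
move=> /imsetP[[x y]] /=; rewrite inE /= => xy CE.
have : exists p, center C = p /\ basis p.1 p.2 && (ball p.1 p.2 == C).
  rewrite /center; case: pickP => [p pC|/(_ (x, y))]; first by exists p.
  by rewrite /= xy CE eqxx.
move=> [[u v] [cE /andP[/= uv /eqP uvC]]]; exists u, v; split=> // z.
by rewrite /affine cE -uvC in_ball /=; case: (a u v z).
Qed.

Let ball_in_balls x y : basis x y -> ball x y \in balls.
Proof. by move=> xy; apply/imsetP; exists (x, y); rewrite // inE. Qed.

Let basis_of u v : u != v -> u != r -> v != r -> basis u v.
Proof. by rewrite /basis /= !inE negb_or => -> -> ->. Qed.

Let root_notin_ball x y : basis x y -> r \notin ball x y.
Proof. by move=> xy; rewrite in_ball negbK; have [_ _ ->] := a_norm xy. Qed.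

Let ball_neq_root x y z : basis x y -> z \in ball x y -> z != r.
Proof. by move=> xy; apply: contraTneq => ->; exact: root_notin_ball. Qed.

Let mem_ball x y : basis x y -> x \in ball x y /\ y \in ball x y.
Proof. by move=> xy; rewrite !in_ball; have [-> -> _] := a_norm xy. Qed.

(** A leaf [z] other than [r] and outside the ball of [x] and [y] would make the
    ball of [x] and [z] larger. *)
Let balls_top : (2 < #|E|)%N -> [set~ r] \in balls.
Proof.
move=> E3.
have [x0 [y0 [x0r y0r xy0]]] : exists x y, [/\ x \in [set~ r], y \in [set~ r] & x != y].
  by apply/card_gt1P; rewrite cardsC1; case: #|E| E3 => [|[|[]]].
have b0 : basis x0 y0 by apply: basis_of; rewrite // -in_setC1.
case: (@arg_maxnP _ (x0, y0) (fun p => basis p.1 p.2)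
  (fun p => #|ball p.1 p.2|) b0) => -[x y] /= xy xymax.
suff -> : [set~ r] = ball x y by exact: ball_in_balls.
apply/eqP; rewrite eq_sym finset.eqEsubset; apply/andP; split; apply/fintype.subsetP => z.
  by rewrite in_setC1; exact: ball_neq_root.
rewrite in_setC1 => zr; apply: contraT => zB.
have [xB yB] := mem_ball xy.
have xz : basis x z.
  by apply: basis_of => //; [apply: contraNneq zB => <-|exact: ball_neq_root xy xB].
have [xB' zB'] := mem_ball xz.
have [sub|/fintype.subsetP/(_ _ zB')] := ball_laminar xy xz xB xB'; last first.
  by rewrite (negPf zB).
suff : (#|ball x y| < #|ball x z|)%N by rewrite ltnNge => /negP[]; exact: (xymax (x, z)).
by apply: proper_card; apply/properP; split=> //; exists z.
Qed.

Let balls_const C D x y : C \in balls -> D \in balls ->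
  D \proper C -> x \in D -> y \in D -> affine C x = affine C y.
Proof.
move=> /ballsP[u [v [uv CE aC]]] /ballsP[u' [v' [uv' DE _]]] DC xD yD.
have DC' := proper_sub DC.
have [u'D v'D] := mem_ball uv'; rewrite -DE in u'D v'D.
have inC z : z \in D -> z \in C by exact: (fintype.subsetP DC').
have u'C : u' \in ball u v by rewrite -CE inC.
have v'C : v' \in ball u v by rewrite -CE inC.
suff sub z : z \in D -> a u v z = a u v u'.
  by apply: Some_inj; rewrite -!aC ?inC // !sub.
move=> zD; have [auv|auv] := eqVneq (a u v u') (a u v v').
  by have [-> //] := ball_collide uv uv' auv u'C; rewrite -DE.
by move: DC; rewrite CE DE (ball_inj uv uv' auv) // fintype.properxx.
Qed.

Let balls_split C x y : C \in balls -> x \in C -> y \in C -> x != y ->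
  affine C x = affine C y ->
  exists2 D, D \in balls & [/\ D \proper C, x \in D & y \in D].
Proof.
move=> /ballsP[u [v [uv CE aC]]] xC yC xy axy.
have bxy : basis x y.
  by apply: basis_of => //; apply: (ball_neq_root uv); rewrite -CE.
exists (ball x y); first exact: ball_in_balls.
have auv : a u v x = a u v y by rewrite !aC // axy.
have [xB yB] := mem_ball bxy; split=> //.
have xC' : x \in ball u v by rewrite -CE.
by rewrite CE; have [] := ball_collide uv bxy auv xC'.
Qed.

Let balls_two C : C \in balls ->
  exists x y, [/\ x \in C, y \in C & affine C x != affine C y].
Proof.
move=> /ballsP[u [v [uv CE aC]]]; exists u, v.
have [uB vB] := mem_ball uv; rewrite -CE in uB vB; split=> //.
have [] := a_norm uv; rewrite (aC u) // (aC v) // => -[->] -[->] _.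
by rewrite eq_sym oner_eq0.
Qed.

(** If [xoo] has collided with [x0] or [x1] at the scale of [x0] and [x1], the
    closer pair is the right scale. *)
Let basis_for x0 x1 xoo : uniq [:: x0; x1; xoo] -> exists x y,
  basis x y /\ uniq [:: a x y x0; a x y x1; a x y xoo].
Proof.
move=> x01oo; have /andP[/andP[n01 n0oo] n1oo] :
    (x0 != x1) && (x0 != xoo) && (x1 != xoo).
  by move: x01oo; rewrite /= !inE negb_or andbT.
have one0 := Some1_neq0 R.
have zero1 : (Some 0 : sphere R) != Some 1 by rewrite eq_sym.
have uniq3 (p q s : sphere R) : p != q -> q != s -> p != s -> uniq [:: p; q; s].
  by rewrite /= !inE negb_or => -> -> ->.
have [roo|roo] := eqVneq xoo r.
  rewrite roo in n0oo n1oo *; exists x0, x1.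
  have b := basis_of n01 n0oo n1oo; have [-> -> ->] := a_norm b.
  by split=> //; exact: uniq3.
have [r0|r0] := eqVneq x0 r.
  rewrite r0 eq_sym in n01; exists x1, xoo.
  have b := basis_of n1oo n01 roo; have [-> -> e] := a_norm b.
  by split=> //; rewrite r0 e; exact: uniq3.
have [r1|r1] := eqVneq x1 r.
  exists x0, xoo.
  have b := basis_of n0oo r0 roo; have [-> -> e] := a_norm b.
  by split=> //; rewrite r1 e; exact: uniq3.
have b := basis_of n01 r0 r1; have [e0 e1 eoo] := a_norm b.
have [d0|d0] := eqVneq (a x0 x1 xoo) (a x0 x1 x0).
  have b' : basis xoo x0 by apply: basis_of; rewrite // eq_sym.
  exists xoo, x0; split=> //; have [f0 f1 _] := a_norm b'.
  have [|e|->] := a_collide b b' d0 _ x1; first by rewrite d0 e0.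
    by move: one0; rewrite -e1 -e0 -d0 e eqxx.
  by rewrite f0 f1; exact: uniq3.
have [d1|d1] := eqVneq (a x0 x1 xoo) (a x0 x1 x1).
  have b' : basis xoo x1 by apply: basis_of; rewrite // eq_sym.
  exists xoo, x1; split=> //; have [f0 f1 _] := a_norm b'.
  have [|e|->] := a_collide b b' d1 _ x0; first by rewrite d1 e1.
    by move: one0; rewrite -e1 -e0 -d1 e eqxx.
  by rewrite f0 f1; exact: uniq3.
exists x0, x1; split=> //.
by rewrite e0 e1 in d0 d1 *; apply: uniq3; rewrite // eq_sym.
Qed.

(** Two pairs with the same ball have coordinates that differ by a Moebius map,
    so the coordinate chosen for the ball separates what any of them does. *)
Lemma coherent_realized : (2 < #|E|)%N ->
  exists H : hierarchy r, realizes H A.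
Proof.
move=> E3.
have clusters_root' C : C \in balls -> r \notin C.
  by move=> /ballsP[u [v [uv CE _]]]; rewrite CE; exact: root_notin_ball.
have laminar C D x : C \in balls -> D \in balls -> x \in C -> x \in D ->
    C \subset D \/ D \subset C.
  move=> /ballsP[u [v [uv CE _]]] /ballsP[u' [v' [uv' DE _]]].
  by rewrite CE DE; exact: ball_laminar.
pose H := Hierarchy (balls_top E3) clusters_root' laminar balls_const
  balls_split balls_two.
exists H => x0 x1 xoo x01oo.
have [x [y [xy axy]]] : exists x y, basis x y /\
    uniq [:: a x y x0; a x y x1; a x y xoo].
  exact: basis_for.
have /ballsP[u [v [uv BE aB]]] := ball_in_balls xy.
have [uB vB] := mem_ball uv; rewrite -BE in uB vB.
have auv : a x y u != a x y v.
  apply/eqP => auv; have [_] := ball_collide xy uv auv uB.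
  by rewrite BE fintype.properxx.
exists (ball x y); first exact: ball_in_balls.
have placeE z : place H (ball x y) z = a u v z.
  rewrite /place /=; case: ifPn => [/aB //|]; rewrite BE in_ball negbK.
  by move=> /eqP.
rewrite !placeE.
have auv01oo : uniq [:: a u v x0; a u v x1; a u v xoo].
  rewrite !in_ball in uB vB.
  rewrite !(a_inj xy uv auv uB vB).
  rewrite -[[:: _; _; _]]/(map (cross_ratio (a x y u) (a x y v) None) [:: _; _; _]).
  rewrite map_inj_uniq //; apply/projective_iso_inj/projective_iso_cross_ratio.
  by rewrite /= !inE negb_or auv uB vB.
split=> // z; rewrite placeE.
exact: (coherent_iso cA).
Qed.

End FromCoherent.
End Coherent.

(** * The tree of spheres of a hierarchy *)

Section HierarchyTree.
Variables (R : realType) (E : finType) (r : E) (H : hierarchy R r).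
Implicit Types (C D : {set E}) (x y z : E).

Let n := #|clusters H|.
Implicit Types (v : 'I_n) (s u w : E + 'I_n).

Let cl v : {set E} := enum_val v.

Let cl_clusters v : cl v \in clusters H. Proof. exact: enum_valP. Qed.

(** Vertices are encoded by sets of leaves, with adjacency the covering relation
    of inclusion. The root leaf [r] gets the whole of [E], so that the top
    cluster is its only child. *)
Let leaves s : {set E} :=
  match s with
  | inl x => if x == r then [set: E] else [set x]
  | inr v => cl v
  end.

Let cl_exists C : C \in clusters H -> exists v, cl v = C.
Proof. by move=> CH; exists (enum_rank_in CH C); exact: enum_rankK_in. Qed.

Let leaves_root s : (r \in leaves s) = (s == inl r).
Proof.
case: s => [x|v] /=; last exact/negbTE/clusters_root.
rewrite (_ : (inl x == inl r) = (x == r)) //.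
by case: (eqVneq x r) => [_|xr]; rewrite !inE // eq_sym (negPf xr).
Qed.

Let two_leaves v : exists x y, [/\ x \in cl v, y \in cl v & x != y].
Proof.
have [x [y [xC yC xy]]] := coord_two (cl_clusters v).
by exists x, y; split=> //; apply: contraNneq xy => ->.
Qed.

Let leaves_neq0 s : exists x, x \in leaves s.
Proof.
case: s => [x|v]; last by have [x [_ [xv _ _]]] := two_leaves v; exists x.
by exists x; rewrite /=; case: ifP; rewrite !inE.
Qed.

Let leaves_leaf x : x != r -> leaves (inl x) = [set x].
Proof. by rewrite /= => /negPf ->. Qed.

Let leaves_inj : injective leaves.
Proof.
move=> s s' e; have [sr|sr] := eqVneq s (inl r).
  by apply/esym/eqP; rewrite sr -leaves_root -e sr leaves_root.
have s'r : s' != inl r by rewrite -leaves_root -e leaves_root.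
have inlr x : inl x != inl r :> E + 'I_n -> x != r by [].
case: s sr e => [x|v]; case: s' s'r => [x'|v'].
- move=> /inlr xr /inlr x'r; rewrite !leaves_leaf // => /set1_inj -> //.
- move=> _ /inlr xr; rewrite leaves_leaf // => /= e.
  have [y [z [yv zv]]] := two_leaves v'.
  by move: yv zv; rewrite -e !inE => /eqP -> /eqP ->; rewrite eqxx.
- move=> /inlr xr _; rewrite leaves_leaf // => /= e.
  have [y [z [yv zv]]] := two_leaves v.
  by move: yv zv; rewrite e !inE => /eqP -> /eqP ->; rewrite eqxx.
- by move=> _ _ /enum_val_inj ->.
Qed.

Let leaves_laminar s s' x : x \in leaves s -> x \in leaves s' ->
  leaves s \subset leaves s' \/ leaves s' \subset leaves s.
Proof.
have lam t t' : x \in leaves t -> x \in leaves t' -> t = inl x \/ t = inl r ->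
    leaves t \subset leaves t' \/ leaves t' \subset leaves t.
  move=> xt xt' [tx|->]; last by right; rewrite /= eqxx finset.subsetT.
  rewrite tx; have [->|xr] := eqVneq x r.
    by right; rewrite /= eqxx finset.subsetT.
  by left; rewrite leaves_leaf // finset.sub1set.
have inlx y : x \in leaves (inl y) ->
    inl y = inl x :> E + 'I_n \/ inl y = inl r :> E + 'I_n.
  have [->|yr] := eqVneq y r; first by right.
  by rewrite leaves_leaf // inE => /eqP ->; left.
move=> xs xs'; case: s xs => [y|v] xs; first exact: (lam _ _ xs xs' (inlx _ xs)).
case: s' xs' => [y|v'] xs'; last first.
  exact: (clusters_laminar (cl_clusters v) (cl_clusters v') xs xs').
by have [|] := lam _ _ xs' xs (inlx _ xs'); [right|left].
Qed.

Let subset_proper s s' : leaves s \subset leaves s' -> s != s' ->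
  leaves s \proper leaves s'.
Proof.
rewrite finset.properEneq => -> ss'; rewrite andbT.
by apply: contraNneq ss' => /leaves_inj ->.
Qed.

Let covers s s' := (leaves s \proper leaves s') &&
  [forall t, ~~ ((leaves s \proper leaves t) && (leaves t \proper leaves s'))].

Let coversP s s' t : covers s s' -> leaves s \proper leaves t ->
  ~~ (leaves t \proper leaves s').
Proof. by move=> /andP[_ /forallP/(_ t)]; rewrite negb_and => /orP[/negPf->|]. Qed.

Let parent_unique s t t' : covers s t -> covers s t' -> t = t'.
Proof.
move=> st st'; apply/eqP; apply: contraT => tt'.
have [x xs] := leaves_neq0 s.
have xt : x \in leaves t by case/andP: st => /proper_sub/fintype.subsetP/(_ x xs).
have xt' : x \in leaves t' by case/andP: st' => /proper_sub/fintype.subsetP/(_ x xs).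
case/andP: (st) => pst _; case/andP: (st') => pst' _.
have [sub|sub] := leaves_laminar xt xt'.
  by case/negP: (coversP st' pst); exact: subset_proper.
by case/negP: (coversP st pst'); apply: subset_proper; rewrite // eq_sym.
Qed.

Let parent_exists s : s != inl r -> exists t, covers s t.
Proof.
move=> sr; have pr : leaves s \proper leaves (inl r).
  by apply: subset_proper => //=; rewrite eqxx finset.subsetT.
case: (@arg_minnP _ (inl r) (fun t => leaves s \proper leaves t)
  (fun t => #|leaves t|) pr) => t st tmin.
exists t; rewrite /covers st /=; apply/forallP => t'.
apply/negP => /andP[/tmin tt' /proper_card].
by rewrite ltnNge tt'.
Qed.

Let child_exists x t : x != r -> x \in leaves t -> t != inl x ->
  exists2 s, covers s t & x \in leaves s.
Proof.
move=> xr xt tx; have px : (x \in leaves (inl x)) && (leaves (inl x) \proper leaves t).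
  rewrite leaves_leaf // !inE eqxx /= -leaves_leaf //.
  by apply: subset_proper; rewrite ?leaves_leaf // ?finset.sub1set // eq_sym.
case: (@arg_maxnP _ (inl x) (fun s => (x \in leaves s) && (leaves s \proper leaves t))
  (fun s => #|leaves s|) px) => s /andP[xs st] smax.
exists s => //; rewrite /covers st /=; apply/forallP => s'.
apply/negP => /andP[ss' s't].
have xs' : x \in leaves s' by exact: (fintype.subsetP (proper_sub ss')).
have := proper_card ss'; rewrite ltnNge => /negP[]; apply: smax.
by rewrite xs' s't.
Qed.

Let hadj s t := covers s t || covers t s.

Let hadj_sym : symmetric hadj.
Proof. by move=> s t; rewrite /hadj orbC. Qed.

Let hadj_irr : irreflexive hadj.
Proof. by move=> s; rewrite /hadj /covers fintype.properxx. Qed.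

Let hadj_root s : connect hadj s (inl r).
Proof.
have [k] := ubnP (#|E| - #|leaves s|); elim: k s => // k IH s sk.
have [->|/parent_exists[t st]] := eqVneq s (inl r); first exact: connect0.
apply: (connect_trans (connect1 (_ : hadj s t))); first by rewrite /hadj st.
apply: IH; case/andP: st => /proper_card st _.
have tE : (#|leaves t| <= #|E|)%N by exact: max_card.
apply: leq_trans (_ : (#|E| - #|leaves s|) <= k)%N => //.
by rewrite ltn_sub2l // (leq_trans st).
Qed.

Let hadj_connected s t : connect hadj s t.
Proof.
apply: (connect_trans (hadj_root s)).
by rewrite (sym_connect_sym hadj_sym) hadj_root.
Qed.

(** A vertex with the smallest set of leaves in a cycle would have both its
    neighbours in the cycle as parents. *)
Let hadj_acyclic c : ucycle hadj c -> (size c < 3)%N.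
Proof.
case: c => // s0 c0 uc; rewrite ltnNge; apply/negP => c3.
have s0c : s0 \in s0 :: c0 by exact: mem_head.
case: (@arg_minnP _ s0 (mem (s0 :: c0)) (fun s => #|leaves s|) s0c) => s sc smin.
have [i c' cE] := rot_to sc.
have cmem t : t \in s :: c' -> t \in s0 :: c0 by rewrite -cE mem_rot.
have : ucycle hadj (s :: c') by rewrite -cE rot_ucycle.
have : (2 < size (s :: c'))%N by rewrite -cE size_rot.
have up t : t \in s :: c' -> hadj s t -> covers s t.
  move=> /cmem tc /orP[//|/andP[/proper_card ts _]].
  by move: ts; rewrite ltnNge smin.
case: c' cE cmem up => // a c' _ _ up; case/lastP: c' up => // c' b up _.
move=> /andP[/= /andP[sa cp] /and3P[_ ac _]].
move: cp; rewrite rcons_path last_rcons => /andP[_ bs].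
have ab : a = b.
  apply: (@parent_unique s); apply: up => //.
  - by rewrite !inE eqxx orbT.
  - by rewrite !inE mem_rcons inE eqxx !orbT.
  - by rewrite hadj_sym.
by move: ac; rewrite ab mem_rcons inE eqxx.
Qed.

Let hadj_leaf x : #|hadj (inl x)| = 1%N.
Proof.
have [->|xr] := eqVneq x r.
  have [t tE] := cl_exists (clusters_top H).
  apply: (fintype.eq_card1 (x := inr t)) => s; rewrite -[LHS]/(hadj _ s) -[RHS]/(s == _).
  have maxr u : u != inl r -> leaves u \subset cl t.
    rewrite tE => ur; apply/fintype.subsetP => y yu; rewrite in_setC1.
    by apply: contraNneq ur => yr; rewrite -leaves_root -yr.
  have tr : cl t \proper leaves (inl r).
    by apply: (@subset_proper (inr t) (inl r)) => //=; rewrite eqxx finset.subsetT.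
  apply/idP/eqP => [|->].
    have notr u : covers (inl r) u = false.
      apply/negbTE/negP => /andP[+ _]; rewrite /= eqxx.
      by rewrite properE finset.subsetT andbF.
    rewrite /hadj notr /= => sr; apply/eqP; apply: contraT => st.
    have srr : s != inl r by apply: contraTneq sr => ->; rewrite notr.
    by case/negP: (coversP sr (@subset_proper s (inr t) (maxr _ srr) st)).
  apply/orP; right; apply/andP; split=> //; apply/forallP => u; apply/negP.
  move=> /andP[tu ur]; move: tu; rewrite properE maxr ?andbF //.
  by apply: contraTneq ur => ->; rewrite fintype.properxx.
have [t st] : exists t, covers (inl x) t.
  by apply: parent_exists; rewrite (_ : (_ == _) = (x == r)).
apply: (fintype.eq_card1 (x := t)) => s; rewrite -[LHS]/(hadj _ s) -[RHS]/(s == _).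
apply/idP/eqP => [|->]; last by rewrite /hadj st.
case/orP => [st'|/andP[+ _]]; first exact: parent_unique st' st.
rewrite leaves_leaf // => /proper_card; rewrite cards1 ltnS leqn0 cards_eq0.
by have [y ys] := leaves_neq0 s => /eqP s0; rewrite s0 inE in ys.
Qed.

Let place_const s v x y : leaves s \proper cl v ->
  x \in leaves s -> y \in leaves s -> place H (cl v) x = place H (cl v) y.
Proof.
move=> sv xs ys; have sub := fintype.subsetP (proper_sub sv).
rewrite /place !sub //; congr Some; case: s sv xs ys sub => [z|w] sv xs ys _.
  have zr : z != r.
    have : r \notin leaves (inl z).
      apply: contraTN sv => rz; rewrite properE negb_and.
      by apply/orP; left; apply/negP => /fintype.subsetP/(_ _ rz);
         apply/negP/(clusters_root (cl_clusters v)).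
    by rewrite leaves_root.
  by move: xs ys; rewrite leaves_leaf // !inE => /eqP -> /eqP ->.
exact: (coord_const (D := cl w)).
Qed.

Let hadj_internal v : (3 <= #|hadj (inr v)|)%N.
Proof.
have [p vp] : exists p, covers (inr v) p by exact: parent_exists.
have [x [y [xv yv xy]]] := coord_two (cl_clusters v).
have notr z : z \in cl v -> z != r.
  by apply: contraTneq => ->; exact: clusters_root.
have [a av xa] := @child_exists x (inr v) (notr _ xv) xv isT.
have [b bv yb] := @child_exists y (inr v) (notr _ yv) yv isT.
have not_both s : covers s (inr v) -> s != p.
  move=> /andP[sv _]; case/andP: vp => vp _.
  apply: contraTneq sv => ->; apply/negP => pv.
  by have := proper_trans vp pv; rewrite fintype.properxx.
apply/card_gt2P; exists p, a, b; split.
  by split; rewrite -[_ \in _]/(hadj _ _) /hadj ?vp ?av ?bv ?orbT.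
split; [by rewrite eq_sym not_both| |exact: not_both].
apply: contraNneq xy => ab; rewrite -ab in yb.
have /andP[pav _] := av; have := place_const pav xa yb.
by rewrite /place xv yv => -[->].
Qed.

Definition hierarchy_shape : comb_tree E :=
  CombTree hadj_sym hadj_irr hadj_connected hadj_acyclic hadj_leaf hadj_internal.

(** Any leaf below [s] will do, since all have the same place. Vertices that are
    not below [v] are in the branch of [r], attached at infinity. *)
Let hattach v s : sphere R :=
  if leaves s \proper cl v then
    if [pick x in leaves s] is Some x then place H (cl v) x else None
  else None.

Let hattachE v s x : leaves s \proper cl v -> x \in leaves s ->
  hattach v s = place H (cl v) x.
Proof.
rewrite /hattach => sv xs; rewrite sv; case: pickP => [y ys|/(_ x)].
  exact: place_const xs.
by rewrite xs.
Qed.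

Let hattach_finite v s : leaves s \proper cl v -> hattach v s != None.
Proof.
move=> sv; have [x xs] := leaves_neq0 s.
by rewrite (hattachE sv xs) /place (fintype.subsetP (proper_sub sv)).
Qed.

Let hattach_leaf v x : hattach v (inl x) = place H (cl v) x.
Proof.
have [xv|xv] := boolP (x \in cl v); last first.
  rewrite /place (negPf xv) /hattach; case: ifP => // /proper_sub/fintype.subsetP sub.
  case/negP: xv; apply: sub; rewrite /=.
  by case: ifP; rewrite !inE.
have xr : x != r by apply: contraTneq xv => ->; exact: clusters_root.
apply: hattachE; last by rewrite leaves_leaf // inE.
by apply: (@subset_proper (inl x) (inr v)); rewrite // leaves_leaf // finset.sub1set.
Qed.

(** Leaves below two different children have different coordinates, since leaves
    with the same coordinate belong to a smaller cluster. *)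
Let hattach_inj v : {in hadj (inr v) &, injective (hattach v)}.
Proof.
move=> s t; rewrite -![_ \in _]/(hadj _ _) => vs vt.
have upN u : covers (inr v) u -> hattach v u = None.
  move=> /andP[vu _]; rewrite /hattach; case: ifP => // uv.
  by have := proper_trans vu uv; rewrite fintype.properxx.
have downS u : covers u (inr v) -> hattach v u != None.
  by move=> /andP[uv _]; exact: hattach_finite.
case/orP: vs => vs; case/orP: vt => vt.
- by move=> _; exact: parent_unique vs vt.
- by rewrite (upN _ vs) => e; have := downS _ vt; rewrite -e.
- by rewrite (upN _ vt) => e; have := downS _ vs; rewrite e.
have meet x : x \in leaves s -> x \in leaves t -> s = t.
  move=> xs xt; apply/eqP; apply: contraT => st.
  case/andP: (vs) => ps _; case/andP: (vt) => pt _.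
  have [sub|sub] := leaves_laminar xs xt.
    by case/negP: (coversP vs (subset_proper sub st)).
  by rewrite eq_sym in st; case/negP: (coversP vt (subset_proper sub st)).
have [x xs] := leaves_neq0 s; have [y yt] := leaves_neq0 t.
case/andP: (vs) => ps _; case/andP: (vt) => pt _.
have xv := fintype.subsetP (proper_sub ps) _ xs.
have yv := fintype.subsetP (proper_sub pt) _ yt.
rewrite (hattachE ps xs) (hattachE pt yt) /place xv yv => -[exy].
have [xy|xy] := eqVneq x y; first by apply: (meet x); rewrite // xy.
have [D DH [Dv xD yD]] := coord_split (cl_clusters v) xv yv xy exy.
have [d dE] := cl_exists DH; rewrite -{}dE in Dv xD yD.
have inside u z : covers u (inr v) -> z \in leaves u -> z \in cl d ->
    cl d \subset leaves u.
  move=> uv zu zd; have [ud|//] := @leaves_laminar u (inr d) z zu zd.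
  have [->//|nud] := eqVneq u (inr d).
  by case/negP: (coversP uv (subset_proper ud nud)).
have ds := fintype.subsetP (inside s x vs xs xD).
by apply: (meet y) => //; exact: ds.
Qed.

Definition hierarchy_tree : sphere_tree R E :=
  @SphereTree R E hierarchy_shape hattach hattach_inj.

(** An edge that avoids [v] stays below one child of [v], or outside the
    cluster of [v]. *)
Let hattach_same_component v s t :
  @same_component E hierarchy_shape (inr v) s t -> hattach v s = hattach v t.
Proof.
have step a b : covers a b -> a != inr v -> b != inr v -> hattach v a = hattach v b.
  move=> ab av bv; have [pab _] := andP ab.
  have [x xa] := leaves_neq0 a; have xb := fintype.subsetP (proper_sub pab) _ xa.
  have [pbv|pbv] := boolP (leaves b \proper cl v).
    by rewrite (hattachE pbv xb) (hattachE (proper_trans pab pbv) xa).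
  rewrite /hattach (negPf pbv); case: ifP => // pav.
  have xv := fintype.subsetP (proper_sub pav) _ xa.
  have [sub|sub] := @leaves_laminar b (inr v) x xb xv.
    by rewrite (@subset_proper b (inr v)) in pbv.
  rewrite eq_sym in bv.
  by case/negP: (@coversP _ _ (inr v) ab pav); exact: (@subset_proper (inr v) b).
case/and3P => _ _ /connectP[p]; elim: p s => [|u p IH] s /=.
  by move=> _ ->.
case/andP => /and3P[/orP[su|us] sv uv] up tE.
  by rewrite (step _ _ su sv uv); exact: IH.
by rewrite -(step _ _ us uv sv); exact: IH.
Qed.

Lemma hierarchy_tree_attach C : C \in clusters H ->
  exists v : 'I_(internal (shape hierarchy_tree)),
    forall x, attach_leaf v x = place H C x.
Proof.
move=> /cl_exists[v <-]; exists v => x.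
have [w vw wx] := @component_neighbor _ (shape hierarchy_tree) (inr v) (inl x) isT.
rewrite -hattach_leaf -(hattach_same_component wx).
exact: (branch_attach vw wx).
Qed.

Lemma alpha_hierarchy_tree A : realizes H A ->
  forall x0 x1 xoo x, uniq [:: x0; x1; xoo] ->
  alpha hierarchy_tree x0 x1 xoo x = A x0 x1 xoo x.
Proof.
move=> HA x0 x1 xoo x u; have [C CH [uC ->]] := HA _ _ _ u.
have [v vE] := hierarchy_tree_attach CH.
by rewrite (@alphaE _ _ _ v) ?separatesE ?vE.
Qed.

End HierarchyTree.

(** * Smoothing a hierarchy *)

Section Star.
Variables (R : realType) (E : finType) (r : E) (b : E -> R[i]).
Hypothesis E3 : (2 < #|E|)%N.
Hypothesis b_inj : {in [set~ r] &, injective b}.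

Let star_root C : C \in [set [set~ r]] -> r \notin C.
Proof. by rewrite inE => /eqP ->; rewrite in_setC1 eqxx. Qed.

Let star_laminar C D x : C \in [set [set~ r]] -> D \in [set [set~ r]] ->
  x \in C -> x \in D -> C \subset D \/ D \subset C.
Proof. by rewrite !inE => /eqP -> /eqP ->; left. Qed.

Let star_const C D x y : C \in [set [set~ r]] -> D \in [set [set~ r]] ->
  D \proper C -> x \in D -> y \in D -> b x = b y.
Proof. by rewrite !inE => /eqP -> /eqP ->; rewrite fintype.properxx. Qed.

Let star_split C x y : C \in [set [set~ r]] -> x \in C -> y \in C -> x != y ->
  b x = b y ->
  exists2 D, D \in [set [set~ r]] & [/\ D \proper C, x \in D & y \in D].
Proof. by rewrite inE => /eqP -> xr yr xy /(b_inj xr yr)/eqP; rewrite (negPf xy). Qed.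

Let star_two C : C \in [set [set~ r]] ->
  exists x y, [/\ x \in C, y \in C & b x != b y].
Proof.
rewrite inE => /eqP ->.
have /card_gt1P[x [y [xr yr xy]]] : (1 < #|[set~ r]|)%N.
  by rewrite cardsC1; case: #|E| E3 => [|[|[]]].
by exists x, y; split=> //; apply: contra_neq xy => /(b_inj xr yr).
Qed.

(** A single cluster: the hierarchy of a sphere marked by [b], and by
    infinity at [r]. *)
Definition star : hierarchy R r :=
  @Hierarchy R E r [set [set~ r]] (fun=> b) (set11 _) star_root
    star_laminar star_const star_split star_two.

End Star.

Section Smoothing.
Local Open Scope classical_set_scope.
Variables (R : realType) (E : finType) (r : E) (H : hierarchy R r).
Implicit Types (C D : {set E}) (x y z : E) (e : R[i]).

Let c C x : R[i] := if (x \in C)%SET then coord H C x else 0.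

(** Each cluster is shrunk by a power of [e] whose exponent is larger for
    smaller clusters, and placed in the larger ones at its attaching point. *)
Definition smoothing e x : R[i] :=
  \sum_(C in clusters H) c C x * e ^+ (#|E| - #|C|).

(** The difference of two marked points in units of the size of [C]. *)
Let gap C x y e : R[i] :=
  \sum_(D in clusters H) (c D y - c D x) * e ^+ (#|C| - #|D|).

(** The clusters that are not smaller than [C] either contain [C], which has
    then collided to a point, or are disjoint from it. *)
Let coef_eq0 C D x y : C \in clusters H -> D \in clusters H -> x \in C -> y \in C ->
  D != C -> (#|C| <= #|D|)%N -> c D y = c D x.
Proof.
move=> CH DH xC yC DC CD.
have nsub : ~~ (D \subset C).
  apply: contraNN DC => sub; rewrite finset.eqEcard sub.
  exact: CD.
have both z : z \in C -> z \in D -> C \proper D.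
  move=> zC zD; have [sub|sub] := clusters_laminar CH DH zC zD; last first.
    by rewrite sub in nsub.
  by rewrite finset.properEneq sub andbT eq_sym.
have const : C \proper D -> c D y = c D x.
  move=> pCD; have sub := fintype.subsetP (proper_sub pCD).
  by rewrite /c !sub //; apply: coord_const pCD _ _.
rewrite /c; case: ifPn => yD; case: ifPn => xD //.
- by have := const (both _ yC yD); rewrite /c yD xD.
- by have := const (both _ yC yD); rewrite /c yD (negPf xD).
- by have := const (both _ xC xD); rewrite /c xD (negPf yD).
Qed.

Let smoothingB C x y e : C \in clusters H -> x \in C -> y \in C ->
  smoothing e y - smoothing e x = e ^+ (#|E| - #|C|) * gap C x y e.
Proof.
move=> CH xC yC; rewrite /smoothing -sumrB /gap mulr_sumr.
apply: eq_bigr => D DH; rewrite -mulrBl mulrCA -exprD.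
have [->|DC] := eqVneq D C; first by rewrite subnn addn0.
have [CD|DC'] := leqP #|C| #|D|.
  by rewrite (coef_eq0 CH DH xC yC DC CD) subrr !mul0r.
congr (_ * _ ^+ _); rewrite addnBA ?(ltnW DC') // subnK //.
exact: max_card.
Qed.

Let gap0 C x y : C \in clusters H -> x \in C -> y \in C ->
  gap C x y 0 = coord H C y - coord H C x.
Proof.
move=> CH xC yC; rewrite /gap (bigD1 C) //= subnn expr0 mulr1 /c xC yC.
rewrite big1 ?addr0 // => D /andP[DH DC].
have [CD|DC'] := leqP #|C| #|D|.
  by rewrite -!/(c _ _) (coef_eq0 CH DH xC yC DC CD) subrr mul0r.
by rewrite expr0n subn_eq0 leqNgt DC' /= mulr0.
Qed.

Let cvg_power (e : nat -> R[i]) (l : R[i]) k : e m @[m --> \oo] --> l ->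
  e m ^+ k @[m --> \oo] --> l ^+ k.
Proof.
move=> el; elim: k => [|k IH].
  by under eq_fun do rewrite expr0; rewrite expr0; exact: cvg_cst.
by under eq_fun do rewrite exprS; rewrite exprS; exact: (cvgM el IH).
Qed.

Let cvg_gap C x y (e : nat -> R[i]) : e m @[m --> \oo] --> (0 : R[i]) ->
  gap C x y (e m) @[m --> \oo] --> gap C x y 0.
Proof.
move=> e0; rewrite /gap; apply: cvg_big => [|D _]; first exact: add_continuous.
have k0 : (c D y - c D x) @[m --> \oo] --> c D y - c D x by exact: cvg_cst.
exact: (cvgM k0 (@cvg_power e 0 _ e0)).
Qed.

(** The smallest cluster that contains both leaves separates them. *)
Let join x y : x != r -> y != r -> x != y -> exists C,
  [/\ C \in clusters H, x \in C, y \in C & coord H C x != coord H C y].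
Proof.
move=> xr yr xy.
pose P C := [&& C \in clusters H, x \in C & y \in C].
have Ptop : P [set~ r]%SET by rewrite /P clusters_top !in_setC1 xr yr.
case: (@arg_minnP _ [set~ r]%SET P (fun C => #|C|) Ptop) => C /and3P[CH xC yC] Cmin.
exists C; split=> //; apply/eqP => cxy.
have [D DH [DC xD yD]] := coord_split CH xC yC xy cxy.
by have := proper_card DC; rewrite ltnNge Cmin // /P DH xD yD.
Qed.

(** The gap of two leaves in the cluster that separates them has a nonzero
    limit. *)
Lemma smoothing_inj (e : nat -> R[i]) : (forall m, e m != 0) ->
  e m @[m --> \oo] --> (0 : R[i]) ->
  \forall m \near \oo, {in [set~ r]%SET &, injective (smoothing (e m))}.
Proof.
move=> e_neq0 e0.
have pair (p : E * E) : \forall m \near \oo, p.1 \in [set~ r]%SET ->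
    p.2 \in [set~ r]%SET -> smoothing (e m) p.1 = smoothing (e m) p.2 -> p.1 = p.2.
  case: p => x y /=; rewrite !in_setC1.
  have [->|xy] := eqVneq x y; first exact: nearW.
  have [->|xr] := eqVneq x r; first exact: nearW.
  have [->|yr] := eqVneq y r; first exact: nearW.
  have [C [CH xC yC cxy]] := join xr yr xy.
  have g0 : 0 < `|gap C x y 0| by rewrite normr_gt0 gap0 // subr_eq0 eq_sym.
  have gN : \forall m \near \oo, `|gap C x y 0 - gap C x y (e m)| < `|gap C x y 0|.
    exact: (near_dist _ (@cvg_gap C x y _ e0) g0).
  apply: filterS gN => m gm _ _ sxy.
  have /eqP := smoothingB (e m) CH xC yC; rewrite sxy subrr eq_sym mulf_eq0.
  rewrite expf_eq0 (negPf (e_neq0 m)) andbF /= => /eqP g.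
  by rewrite g subr0 ltxx in gm.
have {}pair := @filter_forall _ _ _ _ eventually_filter pair.
apply: filterS pair => m pm x y xr yr; exact: (pm (x, y)).
Qed.

(** Blown up at a point of the cluster [C], the smoothing converges to the
    sphere of [C]: a leaf outside [C] is at a distance of larger order. *)
Lemma cvg_smoothing (e : nat -> R[i]) (b : nat -> E -> sphere R) C x0 x1 xoo x :
  (forall m, e m != 0) -> e m @[m --> \oo] --> (0 : R[i]) ->
  (forall m y, b m y = if y == r then None else Some (smoothing (e m) y)) ->
  (C \in clusters H)%SET -> uniq [:: place H C x0; place H C x1; place H C xoo] ->
  cross_ratio (b m x0) (b m x1) (b m xoo) (b m x) @[m --> \oo] -->
  cross_ratio (place H C x0) (place H C x1) (place H C xoo) (place H C x).
Proof.
move=> e_neq0 e0 bE CH u.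
have [y [_ [yC _ _]]] := coord_two CH.
have yr : y != r by apply: contraTneq yC => ->; exact: (clusters_root CH).
(* Only affine coordinates are compared: tau recentres the sphere of C at y,
   and blow m is the dilation that gives the smoothing near y the size of C. *)
pose tau : sphere R -> sphere R := homography 1 (- coord H C y) 0 1.
pose blow m : sphere R -> sphere R :=
  homography 1 (- smoothing (e m) y) 0 (e m ^+ (#|E| - #|C|)).
have tau_iso : projective_iso tau.
  by exists 1, (- coord H C y), 0, 1; split; rewrite // mulr0 subr0 mulr1 oner_eq0.
have blow_iso m : projective_iso (blow m).
  exists 1, (- smoothing (e m) y), 0, (e m ^+ (#|E| - #|C|)); split=> //.
  by rewrite mulr0 subr0 mul1r expf_neq0.
have blow_cvg z : blow m (b m z) @[m --> \oo] --> tau (place H C z).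
  have [->|zr] := eqVneq z r.
    have -> : tau (place H C r) = None.
      rewrite /place (negPf (clusters_root CH)) /tau /homography /of_homog /=.
      by rewrite mul0r mulr0 addr0 eqxx.
    apply: cvg_near_cst; apply: nearW => m; rewrite bE eqxx.
    by rewrite /blow /homography /of_homog /= mul0r mulr0 addr0 eqxx.
  have blowE m : blow m (b m z) = of_homog
      (smoothing (e m) z - smoothing (e m) y, e m ^+ (#|E| - #|C|)).
    rewrite bE (negPf zr) /blow /homography /=.
    by rewrite mul1r !mulr1 mul0r add0r.
  under eq_fun do rewrite blowE.
  have [zC|zC] := boolP (z \in C).
    have -> : tau (place H C z) = of_homog (gap C y z 0, 1).
      by rewrite /place zC /tau /homography gap0 //= mul1r !mulr1 mul0r add0r.
    under eq_fun do rewrite (smoothingB _ CH yC zC)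
      -[X in of_homog (_, X)]mulr1 of_homogZ ?expf_neq0 //.
    apply: cvg_of_homog; first by rewrite oner_eq0 orbT.
      exact: cvg_gap.
    exact: cvg_cst.
  (* D, the cluster separating y from z, is larger than C. *)
  have yz : y != z by apply: contraNneq zC => <-.
  have [D [DH yD zD cyz]] := join yr zr yz.
  have CD : C \proper D.
    have [sub|sub] := clusters_laminar CH DH yC yD.
      by apply/properP; split=> //; exists z.
    by rewrite (fintype.subsetP sub _ zD) in zC.
  have cardCD := proper_card CD.
  have -> : tau (place H C z) = of_homog (gap D y z 0, 0).
    rewrite /place (negPf zC) /tau /homography /of_homog /=.
    by rewrite mul0r mulr0 addr0 eqxx.
  have expE : (#|E| - #|C| = (#|E| - #|D|) + (#|D| - #|C|))%N.
    by rewrite addnBA ?(ltnW cardCD) // subnK // max_card.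
  under eq_fun do rewrite (smoothingB _ DH yD zD) expE exprD of_homogZ ?expf_neq0 //.
  apply: cvg_of_homog; first by rewrite gap0 // subr_eq0 eq_sym cyz.
    exact: cvg_gap.
  move: cardCD; rewrite -subn_gt0; case: (_ - _)%N => // k _.
  by have := @cvg_power _ _ k.+1 e0; rewrite expr0n.
rewrite -(cross_ratio_projective_iso _ _ _ _ tau_iso).
under eq_fun => m do
  rewrite -(cross_ratio_projective_iso (b m x0) _ _ _ (blow_iso m)).
apply: cvg_cross_ratio; [|exact: blow_cvg..].
rewrite -[[:: _; _; _]]/(map tau [:: _; _; _]) map_inj_uniq //.
exact: projective_iso_inj.
Qed.

End Smoothing.

(** * Closure of the moduli space *)

Section CoherentOfCrossRatio.
Variables (R : realType) (E : finType).
Variable A : E -> E -> E -> E -> sphere R.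
Implicit Types (x y z : E).

(** Coherence is a closed condition: the cross-ratio identities that define it
    are polynomial. The generic identity gives the Moebius map, and the one
    for two colliding points gives the degenerate one. *)
Lemma same_cross_ratio_coherent :
  (forall x0 x1 xoo, uniq [:: x0; x1; xoo] ->
    [/\ A x0 x1 xoo x0 = Some 0, A x0 x1 xoo x1 = Some 1
      & A x0 x1 xoo xoo = None]) ->
  (forall x0 x1 xoo y0 y1 yoo, uniq [:: x0; x1; xoo] -> uniq [:: y0; y1; yoo] ->
    forall a b c d, same_cross_ratio
      (A x0 x1 xoo a) (A x0 x1 xoo b) (A x0 x1 xoo c) (A x0 x1 xoo d)
      (A y0 y1 yoo a) (A y0 y1 yoo b) (A y0 y1 yoo c) (A y0 y1 yoo d)) ->
  coherent A.
Proof.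
move=> norm same; split=> //.
  move=> x0 x1 xoo y0 y1 yoo x ux uy uA.
  have [e0 e1 eoo] := norm _ _ _ uy.
  rewrite -[LHS]cross_ratio01oo -e0 -e1 -eoo.
  have u01oo : uniq [:: A y0 y1 yoo y0; A y0 y1 yoo y1; A y0 y1 yoo yoo].
    rewrite e0 e1 eoo; by rewrite /= !inE negb_or eq_sym Some1_neq0.
  apply: eq_of_homog.
  - exact: cross_ratio_neq0.
  - exact: cross_ratio_neq0.
  - exact/esym/(same _ _ _ _ _ _ ux uy x y0 yoo y1).
move=> x0 x1 xoo y0 y1 yoo ux uy nu.
have collide z z' : A x0 x1 xoo z = A x0 x1 xoo z' ->
    A y0 y1 yoo z != A y0 y1 yoo z' ->
    exists p q, forall x, A x0 x1 xoo x = p \/ A y0 y1 yoo x = q.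
  move=> bz gz; exists (A x0 x1 xoo z).
  have [[y yz]|all_p] := pselect (exists y, A x0 x1 xoo y <> A x0 x1 xoo z); last first.
    exists None => x; left; apply: contrapT => xz; apply: all_p.
    by exists x.
  exists (A y0 y1 yoo y) => x.
  have [->|/eqP xz] := pselect (A x0 x1 xoo x = A x0 x1 xoo z); first by left.
  right; apply/esym/eqP; move: (same _ _ _ _ _ _ ux uy z z' y x).
  have bzz : bracket (A x0 x1 xoo z) (A x0 x1 xoo z') == 0.
    by rewrite bracket_eq0 bz.
  rewrite /same_cross_ratio (eqP bzz) !mul0r => /esym/eqP.
  rewrite !mulf_eq0 !bracket_eq0 (negPf gz) -bz /= => /or3P[//|/eqP e|/eqP e].
    by case: yz.
  by rewrite -e eqxx in xz.
have [e0 e1 eoo] := norm _ _ _ uy.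
have one0 := Some1_neq0 R.
move: nu; rewrite /= !inE andbT negb_and negb_or negb_and !negbK.
move=> /orP[/orP[]|] /eqP /collide; rewrite ?e0 ?e1 ?eoo; apply=> //.
by rewrite eq_sym.
Qed.

End CoherentOfCrossRatio.

Section Closure.
Local Open Scope classical_set_scope.
Local Open Scope quotient_scope.
Variables (R : realType) (E : finType).
Implicit Types (T : sphere_tree R E) (f : quad E -> sphere R) (x : E).

(** The values at the marked points of the triple itself complete a family
    indexed by quadruples of distinct elements. *)
Definition extend f x0 x1 xoo x : sphere R :=
  if x == x0 then Some 0 else if x == x1 then Some 1 else
  if x == xoo then None else
  if insub (x0, x1, xoo, x) is Some q then f q else None.

Lemma extend_norm f x0 x1 xoo : uniq [:: x0; x1; xoo] ->
  [/\ extend f x0 x1 xoo x0 = Some 0, extend f x0 x1 xoo x1 = Some 1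
    & extend f x0 x1 xoo xoo = None].
Proof.
rewrite /= !inE negb_or andbT => /andP[/andP[n01 n0oo] n1oo].
rewrite /extend !eqxx; split=> //.
  by rewrite eq_sym (negPf n01).
by rewrite eq_sym (negPf n0oo) eq_sym (negPf n1oo).
Qed.

Lemma extendE f (q : quad E) :
  extend f (val q).1.1.1 (val q).1.1.2 (val q).1.2 (val q).2 = f q.
Proof.
case: q => [[[[x0 x1] xoo] x] u] /=; have := u.
rewrite /extend /= !inE !negb_or !andbT.
move=> /andP[/and3P[_ _ n0] /andP[/andP[_ n1] noo]].
rewrite eq_sym (negPf n0) eq_sym (negPf n1) eq_sym (negPf noo).
by rewrite (insubT (fun q : E * E * E * E => uniq [:: q.1.1.1; q.1.1.2; q.1.2; q.2]) u).
Qed.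

Lemma uniq_triple (q : quad E) :
  uniq [:: (val q).1.1.1; (val q).1.1.2; (val q).1.2].
Proof.
case: q => [[[[x0 x1] xoo] x] /=]; rewrite !inE !negb_or !andbT.
by move=> /andP[/and3P[-> -> _] /andP[/andP[-> _] _]].
Qed.

Lemma cross_ratios_iso_class T (q : quad E) : cross_ratios (iso_class T) q =
  alpha T (val q).1.1.1 (val q).1.1.2 (val q).1.2 (val q).2.
Proof.
rewrite -(@alpha_iso _ _ (repr (iso_class T : {eq_quot @iso_rel R E})) T _ _ _ _ _
  (uniq_triple q)).
  by rewrite /cross_ratios; case: (val q) => [[[x0 x1] xoo] x].
have : iso_rel (repr (iso_class T : {eq_quot @iso_rel R E})) T.
  by apply/eqmodP; rewrite reprK.
by move/asboolP.
Qed.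

Lemma extend_cross_ratios T x0 x1 xoo x : uniq [:: x0; x1; xoo] ->
  extend (cross_ratios (iso_class T)) x0 x1 xoo x = alpha T x0 x1 xoo x.
Proof.
move=> u; have [a0 a1 aoo] := coherent_norm (alpha_coherent T) u.
rewrite /extend; case: (eqVneq x x0) => [->//|n0].
case: (eqVneq x x1) => [->//|n1]; case: (eqVneq x xoo) => [->//|noo].
case: insubP => [q _ qE|/negP[]]; first by rewrite cross_ratios_iso_class qE.
move: u; rewrite /= !inE !negb_or !andbT => /andP[/andP[-> ->] ->].
by rewrite /= eq_sym n0 eq_sym n1 eq_sym noo.
Qed.

Lemma cvg_extend (F : set_system {ptws quad E -> sphere R})
    (f : {ptws quad E -> sphere R}) x0 x1 xoo x : Filter F -> F --> f ->
  extend g x0 x1 xoo x @[g --> F] --> extend f x0 x1 xoo x.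
Proof.
move=> FF Ff; rewrite /extend.
case: ifP => _; first exact: cvg_cst.
case: ifP => _; first exact: cvg_cst.
case: ifP => _; first exact: cvg_cst.
case: insubP => [q _ _|_]; last exact: cvg_cst.
exact: (cvg_comp _ _ Ff (@proj_continuous _ (fun=> sphere R) q f)).
Qed.

Lemma pointwise_cvg (F : set_system {ptws quad E -> sphere R})
    (f : {ptws quad E -> sphere R}) : Filter F ->
  (forall q, g q @[g --> F] --> f q) -> F --> f.
Proof.
move=> FF Ff; apply/cvg_sup => q U.
rewrite nbhsE => -[V [[W oW <-] Wf] VU].
apply: filterS VU _; apply: Ff; exact: open_nbhs_nbhs.
Qed.

Lemma iso_class_repr (k : Mod_hat R E) :
  exists T, k = iso_class T.
Proof. by exists (repr (k : {eq_quot @iso_rel R E})); rewrite /iso_class reprK. Qed.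

(** In a tree with a single internal vertex, all medians are this vertex and
    the maps [alpha] differ by Moebius maps, so the cross-ratio identities hold;
    being polynomial, they pass to the closure. *)
Lemma closure_Mod_coherent (f : {ptws quad E -> sphere R}) :
  closure (@cross_ratios R E @` Mod R E) f -> coherent (extend f).
Proof.
rewrite closureEcvg => -[G PG [Gf GM]].
apply: same_cross_ratio_coherent; first exact: extend_norm.
move=> x0 x1 xoo y0 y1 yoo ux uy a b c d.
apply: (@same_cross_ratio_cvg _ _ G (fun g => extend g x0 x1 xoo a)
  (fun g => extend g x0 x1 xoo b) (fun g => extend g x0 x1 xoo c)
  (fun g => extend g x0 x1 xoo d) (fun g => extend g y0 y1 yoo a)
  (fun g => extend g y0 y1 yoo b) (fun g => extend g y0 y1 yoo c)
  (fun g => extend g y0 y1 yoo d)); [exact: cvg_extend..|].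
apply: GM => _ [_ [T T1 <-] <-].
rewrite !extend_cross_ratios //.
have [v sv] := separates_exists (shape T) ux.
have [w sw] := separates_exists (shape T) uy.
have vw : w = v.
  have ord1' n (i j : 'I_n) : n = 1%N -> i = j.
    by move=> n1; subst n; rewrite !ord1.
  exact: ord1'.
rewrite vw in sw; rewrite !(alphaE _ sv) !(alphaE _ sw).
by apply: same_cross_ratio_projective_iso; apply: projective_iso_cross_ratio;
  rewrite -separatesE.
Qed.

(** The stars of the smoothings belong to [Mod], and each cross-ratio is
    computed in the limit on the sphere of the cluster that realizes it. *)
Lemma realized_closure_Mod r (H : hierarchy R r) (f : {ptws quad E -> sphere R}) :
  (2 < #|E|)%N -> realizes H (extend f) ->
  closure (@cross_ratios R E @` Mod R E) f.
Proof.
move=> E3 Hf.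
pose e m : R[i] := (harmonic m : R)%:C.
have e_neq0 m : e m != 0.
  by rewrite /e (fmorph_eq0 (real_complex R)) invr_eq0 pnatr_eq0.
have e0 : e m @[m --> \oo] --> (0 : R[i]).
  exact: (cvg_comp _ _ (@cvg_harmonic R) (@real_complex_continuous R 0)).
pose b m y : sphere R := if y == r then None else Some (smoothing H (e m) y).
pose g m : {ptws quad E -> sphere R} := fun q =>
  cross_ratio (b m (val q).1.1.1) (b m (val q).1.1.2) (b m (val q).1.2)
              (b m (val q).2).
have gf : g @ \oo --> f.
  apply: pointwise_cvg => q; rewrite -(extendE f q).
  have [|C CH [uC ->]] := Hf (val q).1.1.1 (val q).1.1.2 (val q).1.2;
    first exact: uniq_triple.
  exact: (@cvg_smoothing _ _ _ H e b C _ _ _ (val q).2 e_neq0 e0 _ CH uC).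
have gM : \forall m \near \oo, (@cross_ratios R E @` Mod R E) (g m).
  have e_inj := @smoothing_inj _ _ _ H e e_neq0 e0.
  apply: filterS e_inj => m b_inj.
  pose S := star E3 b_inj.
  exists (iso_class (hierarchy_tree S)).
    exists (hierarchy_tree S) => //.
    exact: (@cards1 _ [set~ r]%SET).
  apply: funext => q; rewrite cross_ratios_iso_class.
  have [v vE] := hierarchy_tree_attach (clusters_top S).
  have placeE y : place S [set~ r]%SET y = b m y.
    by rewrite /place /b in_setC1; case: eqP.
  have binj : injective (b m).
    move=> y z; rewrite /b.
    have [->|yr] := eqVneq y r; have [->|zr] := eqVneq z r => // -[].
    by move=> e_yz; apply: (b_inj _ _ _ _ e_yz); rewrite in_setC1.
  rewrite (@alphaE _ _ _ v) ?separatesE ?vE ?placeE //.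
  rewrite -[[:: _; _; _]]/(map (b m) [:: _; _; _]) (map_inj_uniq binj).
  exact: uniq_triple.
move=> U /gf gU; have [m [gm Ugm]] := filter_ex (filterI gM gU).
by exists (g m).
Qed.

End Closure.

Local Open Scope classical_set_scope.

Theorem theorem1 (R : realType) (E : finType) (hE : (2 < #|E|)%N) :
  range (@cross_ratios R E) = closure (@cross_ratios R E @` Mod R E).
Proof.
have [r _] : exists r, r \in E by apply/card_gt0P; exact: leq_trans hE.
apply/seteqP; split=> [_ [k _ <-]|f fM].
  have [T ->] := iso_class_repr k.
  have [H HT] := coherent_realized r (alpha_coherent T) hE.
  apply: (realized_closure_Mod (H := H)) => // x0 x1 xoo u.
  have [C CH [uC aC]] := HT _ _ _ u; exists C => //; split=> // x.
  by rewrite extend_cross_ratios.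
have [H Hf] := coherent_realized r (closure_Mod_coherent fM) hE.
exists (iso_class (hierarchy_tree H)) => //.
apply: funext => q; rewrite cross_ratios_iso_class (alpha_hierarchy_tree Hf).
  exact: extendE.
exact: uniq_triple.
Qed.
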